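(* Let $\alpha\in[0,1/2)$ and $\Omega\in(0,\pi)$, and let $\rho$, $\mathcal{V}(\rho,\Omega)$, $N$ and $g$ be as defined in the context. For $t\in\mathbb{R}$ let $m=\lfloor t-N\rfloor$, i.e. $t\in[N+m,N+m+1)$, and let $$a_m(t)=1-\frac{g(t)}{\pi},\qquad a_k(t)=\frac{(t-m)\sin[g(t)(k-m)]}{\pi(k-m)(k-t)},\quad k\in\mathbb{Z},\ k\neq m,$$ where in the case $k=t$ one sets $a_k(k)=1$. Then, for every $x\in\mathcal{V}(\rho,\Omega)$, $$x(t)=\sum_{k\in\mathbb{Z}}a_k(t)\,x(k),\qquad t\in\mathbb{R}.$$ The series is absolutely convergent for each $t$, and it is absolutely convergent uniformly on any bounded interval of $\mathbb{R}$.
   Context: For $\alpha\ge 0$ let $\rho(t)=(1+|t|)^{-\alpha}$, $t\in\mathbb{R}$. $\rho^{-1}L_\infty(\mathbb{R})$ is the space of measurable $f:\mathbb{R}\to\mathbb{C}$ (up to a.e. equality) with $\|\rho f\|_{L_\infty(\mathbb{R})}<\infty$; $\rho L_1(\mathbb{R})$ is the space of $f:\mathbb{R}\to\mathbb{C}$ with $\|\rho^{-1}f\|_{L_1(\mathbb{R})}<\infty$. For $\Omega>0$, $\mathcal{V}(\rho,\Omega)$ is the set of all $x\in\rho^{-1}L_\infty(\mathbb{R})$ such that $\int_{-\infty}^\infty x(t)y(t)\,dt=0$ for every $y\in\rho L_1(\mathbb{R})$ whose Fourier transform $Y(\omega)=\int_{-\infty}^{\infty}e^{-i\omega t}y(t)\,dt$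 vanishes identically on $(-\Omega,\Omega)$. Elements of $\mathcal{V}(\rho,\Omega)$ are continuous (known fact), i.e. $x$ denotes the continuous representative. $N$ is a fixed even positive integer with $N>\Omega/(\pi-\Omega)$. The function $g:\mathbb{R}\to\mathbb{R}$ is the $1$-periodic function with $g(t)=\pi N/t$ for $t\in[N,N+1)$. (Thus $g(t)(t-m)=\pi N$ for $t\in[N+m,N+m+1)$, $m\in\mathbb{Z}$, and $g(m)=\pi$ for integer $m$.) $\lfloor\cdot\rfloor$ is the usual integer part (floor). *)

(* Defs.v *)
From HB Require Import structures.
From mathcomp Require Import all_boot all_order all_algebra.
From mathcomp Require Import all_classical all_reals all_analysis.
From mathcomp Require Import finmap complex.
From mathcomp Require Import summability.

Set Implicit Arguments.
Unset Strict Implicit.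
Unset Printing Implicit Defensive.

Import Order.TTheory GRing.Theory Num.Theory.
Import numFieldNormedType.Exports.

Local Open Scope classical_set_scope.
Local Open Scope ring_scope.
Local Open Scope complex_scope.

Section BandLimited.
Context {R : realType}.
Local Notation mu := (@lebesgue_measure R).

Definition cmeasurable (f : R -> R[i]) : Prop :=
  measurable_fun setT (fun t => complex.Re (f t)) /\
  measurable_fun setT (fun t => complex.Im (f t)).

(* In the two uses below the integrand is integrable: rho <= 1, so
   [L1_weighted (rho alpha)] is contained in L1, and x * y is dominated by
   `|rho * x| * `|rho^-1 * y|. *)
Definition cintegral (f : R -> R[i]) : R[i] :=
  (\int[mu]_t complex.Re (f t)) +i* (\int[mu]_t complex.Im (f t)).

Definition rho (alpha t : R) : R := (1 + `|t|) `^ (- alpha).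

(* Functions stand for their a.e. classes. *)
Definition Linfty_weighted (w : R -> R) : set (R -> R[i]) :=
  [set f | cmeasurable f /\
    (Lnorm mu +oo (fun t => (w t * Normc.normc (f t))%:E) < +oo)%E].

Definition L1_weighted (w : R -> R) : set (R -> R[i]) :=
  [set f | cmeasurable f /\
    (Lnorm mu 1 (fun t => ((w t)^-1 * Normc.normc (f t))%:E) < +oo)%E].

Definition fourier (y : R -> R[i]) (omega : R) : R[i] :=
  cintegral (fun t => (cos (omega * t) -i* sin (omega * t)) * y t).

(* The space V(w, Omega). *)
Definition band_limited (w : R -> R) (Omega : R) : set (R -> R[i]) :=
  [set x | Linfty_weighted w x /\
    forall y, L1_weighted w y ->
      (forall omega, - Omega < omega < Omega -> fourier y omega = 0) ->
      cintegral (fun t => x t * y t) = 0].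

(* The cases k = m and k = t exclude each other when 0 < N, because then
   m <= t - N < t. *)
Definition coef (N : nat) (g : R -> R) (k : int) (t : R) : R :=
  let m := Num.floor (t - N%:R) in
  if k == m then 1 - g t / pi
  else if k%:~R == t then 1
  else (t - m%:~R) * sin (g t * (k - m)%:~R) /
       (pi * (k - m)%:~R * (k%:~R - t)).

(* To be summed over k in int with [partial_sum] along [totally], the filter
   of finite subsets of int ordered by inclusion. *)
Definition sampling_term (N : nat) (g : R -> R) (x : R -> R[i]) (t : R) (k : int)
  : R[i] := (coef N g k t)%:C * x k%:~R.

End BandLimited.

(* Main.v *)
Require Import Defs.
From HB Require Import structures.
From mathcomp Require Import all_boot all_order all_algebra.
From mathcomp Require Import all_classical all_reals all_analysis.
From mathcomp Require Import finmap complex.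
From mathcomp Require Import summability.
From mathcomp Require Import measurable_realfun ess_sup_inf.
From mathcomp Require Import ring lra zify.

Set Implicit Arguments.
Unset Strict Implicit.
Unset Printing Implicit Defensive.

Import Order.TTheory GRing.Theory Num.Theory.
Import numFieldNormedType.Exports.

Local Open Scope classical_set_scope.
Local Open Scope ring_scope.
Local Open Scope complex_scope.

(* For fixed [t] put [tau = t - m] and [c = g t], so that [c * tau = pi * N].
   As [N] is even, the function equal to [expi (tau * u)] for [|u| <= c] and to
   [1] on the rest of [[- pi, pi]] has a continuous periodic extension, and the
   coefficients of the theorem are its Fourier coefficients, shifted by [m].
   They are absolutely summable and [Omega < c], hence
   [sum_k a_k(t) * expi (k * w) = expi (t * w)] for [|w| < Omega].
   Consequently the function [\1_[t, t + e] - sum_k a_k(t) * \1_[k, k + e]] has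
   a Fourier transform vanishing on [(- Omega, Omega)].  The signal [x] is
   orthogonal to it, that is, the mean of [x] over [[t, t + e]] is the sum of
   the [a_k(t)] times the means over [[k, k + e]]; then let [e] tend to [0].

   Everything is done with real integrals: the identity for [expi] is proved
   as [sum_k a_k(t) * cos (k * w + p) = cos (t * w + p)] for every phase [p]. *)

(* Over the whole of $[-\pi,\pi]$ the function $e^{i\tau u}$ generally jumps at the ends, and its
   Fourier coefficients decay only like $1/|k|$. Cutting it at $c=\pi N/\tau$, where it takes the
   value $e^{i\pi N}=1$, and continuing it by 1 removes the jump and gives coefficients of order
   $k^{-2}$. The signal is $O(|k|^{1/2})$, because $\alpha<1/2$, so the terms are $O(|k|^{-3/2})$;
   this one estimate yields the absolute and the uniform convergence, the integrability of the test
   functions and the limit [e --> 0]. It also settles the existence of the limits beforehand. What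
   remains is to identify them, hence the statements that take a limit [L] as given and compute it,
   along a convenient sequence of finite sets or by Cesaro means. Cosines with arbitrary phase are
   stable, up to linear combinations, under the shift by [m], integration over a translated interval
   and the passage from real to imaginary part. *)
#[local] Existing Instance totally_filter.

(** * Unordered sums of real families *)

Section UnconditionalSums.
Context {R : realType} {I : choiceType}.
Implicit Types (u v : I -> R) (A B : {fset I}).

Lemma partial_sumE (V : zmodType) (u : I -> V) A :
  partial_sum u A = \sum_(k <- A) u k.
Proof. by rewrite /partial_sum big_seq_fsetE. Qed.

Lemma partial_sum_seq_fset (V : zmodType) (u : I -> V) (s : seq I) :
  uniq s -> partial_sum u (seq_fset tt s) = \sum_(k <- s) u k.
Proof. move=> us; rewrite partial_sumE; apply: perm_big.
by rewrite -[X in perm_eq _ X](undup_id us) seq_fset_perm. Qed.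

Lemma partial_sum_fsetD (V : zmodType) (u : I -> V) A B : (A `<=` B)%fset ->
  partial_sum u B = partial_sum u A + partial_sum u (B `\` A)%fset.
Proof.
move=> AB; rewrite !partial_sumE (big_fsetID _ (mem A))/=.
congr (_ + _); apply: eq_fbigl => k; rewrite !inE ?andbT.
  by apply/andP/idP => [[]//|kA]; split => //; exact: (fsubsetP AB).
by rewrite andbC.
Qed.

Lemma ler_partial_sum u v A : (forall k, k \in A -> u k <= v k) ->
  partial_sum u A <= partial_sum v A.
Proof.
move=> uv; rewrite !partial_sumE big_seq [leRHS]big_seq.
exact: ler_sum.
Qed.

Lemma ler_norm_partial_sum u A :
  `|partial_sum u A| <= partial_sum (fun k => `|u k|) A.
Proof. by rewrite !partial_sumE ler_norm_sum. Qed.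

Lemma partial_sum_ge0 u A : (forall k, 0 <= u k) -> 0 <= partial_sum u A.
Proof. by move=> u0; rewrite partial_sumE sumr_ge0. Qed.

Lemma near_totally A (P : {fset I} -> Prop) :
  (forall B, (A `<=` B)%fset -> P B) -> \forall B \near totally, P B.
Proof. by move=> AP; exists A. Qed.

(** The partial sums of the absolute values have a supremum. Once [A] comes within [e] of it, a set
    disjoint from [A] can add at most [e]. *)
Lemma partial_sum_tail u (M : R) (e : R) : 0 < e ->
  (forall A, partial_sum (fun k => `|u k|) A <= M) ->
  exists A, forall B, [disjoint A & B]%fset -> partial_sum (fun k => `|u k|) B <= e.
Proof.
move=> e0 uM; set v := fun k => `|u k|.
pose E := range (partial_sum v).
have supE : has_sup E.
  split; first by exists (partial_sum v fset0%fset), fset0%fset.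
  by exists M => _ [A _ <-]; exact: uM.
have [_ [A _ <-] supA] := sup_adherent e0 supE.
exists A => B dAB; have ABE : E (partial_sum v (A `|` B)%fset) by exists (A `|` B)%fset.
have := sup_ubound (proj2 supE) ABE.
rewrite (@partial_sum_fsetD _ v A) ?fsubsetUl// fsetDUl fsetDv fset0U.
move: dAB; rewrite fdisjoint_sym => /fsetDidPl ->; move: supA.
by set a := partial_sum v A; set b := partial_sum v B; set c := sup E; lra.
Qed.

Lemma cvg_partial_sum u (M : R) :
  (forall A, partial_sum (fun k => `|u k|) A <= M) ->
  cvg (partial_sum u @ totally).
Proof.
move=> uM; apply/cauchy_cvgP/cauchy_ballP => e e0.
have e20 : 0 < e / 4 by lra.
have [A hA] := partial_sum_tail e20 uM.
have hB B : (A `<=` B)%fset -> `|partial_sum u B - partial_sum u A| <= e / 4.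
  move=> AB; rewrite (partial_sum_fsetD _ AB) addrC addKr.
  apply: (le_trans (ler_norm_partial_sum _ _)); apply: hA.
  by rewrite fdisjoint_sym; apply/fdisjointP => k; rewrite inE => /andP[].
pose V := [set z : R | `|z - partial_sum u A| <= e / 4].
have VA : \forall B \near totally, V (partial_sum u B).
  by apply: (@near_totally A) => B; exact: hB.
exists (V, V) => /=; first by split; exact: VA.
move=> [y z]/= []; rewrite /V /ball/=.
set a := partial_sum u A; rewrite !ler_norml ltr_norml; lra.
Qed.

(** Each index of a fixed finite set eventually lies in [A_ n], hence so does the set, by induction
    on its subsets. Limits along [totally] thereby become limits of sequences, to which the theorems
    on integrals apply. *)
Lemma cvg_totally_comp (T : topologicalType) (F : {fset I} -> T) (l : T)
    (A_ : nat -> {fset I}) :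
  F @ totally --> l -> (forall k, \forall n \near \oo, k \in A_ n) ->
  F (A_ n) @[n --> \oo] --> l.
Proof.
move=> Fl Aoo; apply: cvg_comp Fl => P [A _ AP].
suff : \forall n \near \oo, (A `<=` A_ n)%fset by apply: filterS => n; exact: AP.
elim/finSet_rect: A {AP} => A IH; have [->|[k kA]] := fset_0Vmem A.
  by apply: nearW => n; exact: fsub0set.
have Ak : (A `\ k `<` A)%fset by rewrite fproperD1.
near=> n; rewrite -(fsetD1K kA) fsubUset fsub1set.
by apply/andP; split; near: n; [exact: Aoo|exact: IH].
Unshelve. all: by end_near. Qed.

End UnconditionalSums.

(** * Exhaustion of the integers by half-open intervals *)

Section IntegerSums.

(* The integers of the interval [- n, n[. *)
Definition zball (n : nat) : {fset int} :=
  seq_fset tt (map Posz (iota 0 n) ++ map Negz (iota 0 n)).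

Lemma zball_uniq n : uniq (map Posz (iota 0 n) ++ map Negz (iota 0 n)).
Proof.
rewrite cat_uniq !map_inj_uniq ?iota_uniq// => [|i j []|i j []]//.
by rewrite andbT; apply/hasPn => _ /mapP[i _ ->]; apply/mapP => -[].
Qed.

Lemma in_zball (n : nat) (k : int) :
  (k \in zball n) = (- (n%:Z) <= k < n%:Z).
Proof.
rewrite seq_fsetE mem_cat; case: k => i.
- rewrite mem_map; last by move=> ? ? [].
  rewrite mem_iota/= add0n (_ : (Posz i \in _) = false) ?orbF; first by lia.
  by apply/negbTE/mapP => -[].
- rewrite (mem_map (f := Negz)); last by move=> ? ? [].
  rewrite mem_iota/= add0n (_ : (Negz i \in _) = false) ?orFb; first by lia.
  by apply/negbTE/mapP => -[].
Qed.

(** As [Negz i] is [- (i + 1)], the half-open range pairs the indices so that a sum over [int]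
    becomes an ordinary series. *)
Lemma partial_sum_zball (V : zmodType) (u : int -> V) n :
  partial_sum u (zball n) = \sum_(0 <= i < n) (u (Posz i) + u (Negz i)).
Proof.
rewrite /zball partial_sum_seq_fset ?zball_uniq//.
rewrite big_cat/= !big_map big_split/=.
by rewrite /index_iota subn0.
Qed.

Lemma near_zball (k : int) : \forall n \near \oo, k \in zball n.
Proof. by exists (`|k|%N.+1) => // n /=; rewrite in_zball; lia. Qed.

Lemma le_zball m n : (m <= n)%N -> (zball m `<=` zball n)%fset.
Proof. by move=> mn; apply/fsubsetP => k; rewrite !in_zball; lia. Qed.

Lemma sub_zball (A : {fset int}) : exists n, (A `<=` zball n)%fset.
Proof.
exists (\max_(k <- A) `|k|%N.+1); apply/fsubsetP => k kA; rewrite in_zball.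
have : (`|k|.+1 <= \max_(k <- A) `|k|%N.+1)%N by rewrite leq_bigmax_seq.
lia.
Qed.

End IntegerSums.

(** * Tails of the series of $(1+|k|)^{-3/2}$ *)

Section TailBound.
Context {R : realType}.

(** This is $(1+|k|)^{-3/2}$, the decay $|k|^{-2}$ of the coefficients times the growth $|k|^{1/2}$
    of the signal. *)
Definition zweight (k : int) : R :=
  ((1 + `|k%:~R|) * Num.sqrt (1 + `|k%:~R|))^-1.

Lemma zweight_gt0 k : 0 < zweight k.
Proof. by rewrite invr_gt0 mulr_gt0// ?sqrtr_gt0 ltr_wpDr. Qed.

(** For the roots [a], [b] of [i] and [i + 1], [b ^+ 2 - a ^+ 2 = 1] turns $1/a-1/b$ into
    $1/(ab(a+b))$, which is at least $1/(2b^3)$. *)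
Lemma zweight_telescope (i : nat) : (0 < i)%N ->
  ((1 + i%:R) * Num.sqrt (1 + i%:R))^-1 <=
  2 * ((Num.sqrt i%:R)^-1 - (Num.sqrt (i.+1)%:R)^-1) :> R.
Proof.
move=> i0; have -> : i.+1%:R = 1 + i%:R :> R by rewrite -natr1 addrC.
set a := Num.sqrt i%:R; set b := Num.sqrt (1 + i%:R).
have a0 : 0 < a by rewrite sqrtr_gt0 ltr0n.
have i0' : (0 : R) < i%:R by rewrite ltr0n.
have bb : b ^+ 2 = 1 + i%:R by rewrite sqr_sqrtr; lra.
have aa : a ^+ 2 = i%:R by rewrite sqr_sqrtr; lra.
have ab : a < b by rewrite ltr_sqrt; lra.
have b0 : 0 < b by lra.
rewrite -bb -[_^-1 - _^-1](_ : (b - a) / (a * b) = _); last first.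
  by field; rewrite !gt_eqF.
have -> : b - a = (b + a)^-1.
  apply: (mulIf (x := b + a)); first by rewrite gt_eqF// addr_gt0.
  by rewrite mulVf ?gt_eqF ?addr_gt0// -subr_sqr bb aa; lra.
rewrite -invfM -ler_pdivrMl// -invfM lef_pV2 ?posrE; last 2 first.
- by rewrite !mulr_gt0// exprn_gt0.
- by rewrite !mulr_gt0// addr_gt0.
have : a * (a + b) <= b * (b + b) by apply: ler_pM; lra.
by rewrite expr2 => h; have := ler_wpM2r (ltW b0) h; lra.
Qed.

(** The factor 4 is the 2 of the telescoping bound, counted once for [Posz i] and once for
    [Negz i]. *)
Lemma sum_zweight (K n : nat) : (0 < K <= n)%N ->
  \sum_(K <= i < n) (zweight (Posz i) + zweight (Negz i)) <=
  4 * ((Num.sqrt K%:R)^-1 - (Num.sqrt n%:R)^-1).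
Proof.
move=> /andP[K0 Kn]; rewrite -opprB.
rewrite -(telescope_sumr (fun i => (Num.sqrt i%:R)^-1) Kn) -sumrN mulr_sumr.
rewrite big_nat [leRHS]big_nat; apply: ler_sum => i /andP[Ki _].
have i0 : (0 < i)%N by exact: leq_trans Ki.
have h := zweight_telescope i0.
have zP : zweight (Posz i) = ((1 + i%:R) * Num.sqrt (1 + i%:R))^-1.
  by rewrite /zweight -pmulrn ger0_norm.
have zN : zweight (Negz i) <= zweight (Posz i).
  rewrite /zweight NegzE mulrNz normrN -!pmulrn !ger0_norm//.
  rewrite lef_pV2 ?posrE ?mulr_gt0 ?sqrtr_gt0 ?ltr_wpDr//.
  by apply: ler_pM; rewrite ?addr_ge0 ?sqrtr_ge0 ?ler_wsqrtr// lerD2l ler_nat.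
by move: zN h; rewrite zP opprB; set x := zweight _; set y := _^-1; lra.
Qed.

(** Adding [zball K] to [A] and enlarging the union to some [zball n] leaves only the telescoping
    block from [K] to [n]. *)
Lemma partial_sum_zweight (K : nat) (A : {fset int}) : (0 < K)%N ->
  [disjoint A & zball K]%fset ->
  partial_sum zweight A <= 4 / Num.sqrt K%:R.
Proof.
move=> K0 dAK; have [n0 An] := sub_zball A; pose n := maxn n0 K.
have AKn : (A `|` zball K `<=` zball n)%fset.
  rewrite fsubUset (fsubset_trans An) ?le_zball ?leq_maxl//.
  by rewrite leq_maxr.
have KAK : (zball K `<=` A `|` zball K)%fset by exact: fsubsetUr.
have : partial_sum zweight (A `|` zball K)%fset <= partial_sum zweight (zball n).
  rewrite (partial_sum_fsetD _ AKn) lerDl partial_sum_ge0// => k.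
  exact/ltW/zweight_gt0.
rewrite (partial_sum_fsetD _ KAK) fsetDUl fsetDv fsetU0.
rewrite (fsetDidPl _ _ dAK) !partial_sum_zball (@big_cat_nat _ _ _ K 0%N n)//=; last first.
  exact: leq_maxr.
rewrite lerD2l => /le_trans; apply.
apply: (le_trans (sum_zweight _)); first by rewrite K0 leq_maxr.
by rewrite ler_wpM2l// gerBl invr_ge0 sqrtr_ge0.
Qed.

End TailBound.

(** * Real-valued integrals over a measure space *)

Section GenericIntegrals.
Context d {T : measurableType d} {R : realType} (mu : {measure set T -> \bar R}).

Lemma Rdominated_convergence (D : set T) (f_ : (T -> R)^nat) (f h : T -> R) :
  measurable D -> (forall n, measurable_fun D (f_ n)) ->
  (forall x, D x -> f_ n x @[n --> \oo] --> f x) ->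
  mu.-integrable D (EFin \o h) ->
  (forall n x, D x -> `|f_ n x| <= h x) ->
  mu.-integrable D (EFin \o f) /\
  (\int[mu]_(x in D) f_ n x) @[n --> \oo] --> \int[mu]_(x in D) f x.
Proof.
move=> mD mf_ f_f ih f_h.
have mf : measurable_fun D f by exact: measurable_fun_cvg f_f.
have [||||| intf _ cvgf] := @dominated_convergence _ _ _ mu D mD
    (fun n => EFin \o f_ n) (EFin \o f) (EFin \o h).
- by move=> n; exact/measurable_EFinP/mf_.
- exact/measurable_EFinP.
- by apply: aeW => x Dx; apply: cvg_EFin; [exact: nearW|exact: f_f].
- exact: ih.
- by apply: aeW => x n Dx; rewrite /= lee_fin f_h.
split => //; apply: fine_cvg; rewrite fineK//; exact: integrable_fin_num.
Qed.

Lemma Rintegral_sum (D : set T) (I : Type) (s : seq I) (F : I -> T -> R) :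
  measurable D -> (forall i, mu.-integrable D (EFin \o F i)) ->
  \int[mu]_(x in D) (\sum_(i <- s) F i x) =
  \sum_(i <- s) \int[mu]_(x in D) F i x.
Proof.
move=> mD iF; rewrite /Rintegral; under eq_integral do rewrite -sumEFin.
rewrite integral_sum// -sum_fine// => i _.
exact: (integrable_fin_num mD (iF i)).
Qed.

Lemma integrable_EFinB (D : set T) (f h : T -> R) : measurable D ->
  mu.-integrable D (EFin \o f) -> mu.-integrable D (EFin \o h) ->
  mu.-integrable D (EFin \o (fun x => f x - h x)).
Proof.
move=> mD If Ih; have := integrableB mD If Ih.
by apply: eq_integrable => // x _ /=; rewrite EFinB.
Qed.

Lemma integrable_EFinZl (D : set T) (f : T -> R) (c : R) : measurable D ->
  mu.-integrable D (EFin \o f) -> mu.-integrable D (EFin \o (fun x => c * f x)).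
Proof.
move=> mD If; have := integrableZl mD c If.
by apply: eq_integrable => // x _ /=; rewrite EFinM.
Qed.

End GenericIntegrals.

(** * Integrals of continuous functions and cosines over segments *)

Section RealIntegrals.
Context {R : realType}.
Local Notation mu := (@lebesgue_measure R).

Lemma continuous_integrable (f : R -> R) (a b : R) :
  continuous f -> mu.-integrable `[a, b] (EFin \o f).
Proof.
move=> cf; apply: continuous_compact_integrable; first exact: segment_compact.
by apply: continuous_subspaceT.
Qed.

Lemma continuous_sum (I : Type) (s : seq I) (F : I -> R -> R) :
  (forall i, continuous (F i)) -> continuous (fun u => \sum_(i <- s) F i u).
Proof.
move=> cF; elim: s => [|i s IH] u.
  by under eq_fun do rewrite big_nil; exact: cvg_cst.
rewrite (_ : (fun u => _) = fun u => F i u + \sum_(j <- s) F j u); last first.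
  by apply/funext => v; rewrite big_cons.
by apply: cvgD; [exact: cF|exact: IH].
Qed.

Lemma continuous_cos_affine (s p : R) : continuous (fun u : R => cos (s * u + p)).
Proof.
move=> u; apply: continuous_comp; last exact: continuous_cos.
by apply: cvgD; [apply: cvgM; [exact: cvg_cst|exact: cvg_id]|exact: cvg_cst].
Qed.

Lemma Rintegral_cos_affine (s p a b : R) : a <= b ->
  \int[mu]_(u in `[a, b]) cos (s * u + p) =
  if s == 0 then (b - a) * cos p else (sin (s * b + p) - sin (s * a + p)) / s.
Proof.
rewrite le_eqVlt => /predU1P[<-|ab].
  by rewrite set_itv1 Rintegral_set1 !subrr !mul0r if_same.
case: eqVneq => [->|s0].
  under eq_Rintegral do rewrite mul0r add0r.
  by rewrite Rintegral_cst//= lebesgue_measure_itv/= lte_fin ab mulrC.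
pose F (u : R) := sin (s * u + p) / s.
have dF (u : R) : is_derive u 1 F (cos (s * u + p)).
  have -> : cos (s * u + p) = s^-1 *: (cos (s * u + p) * s).
    by rewrite /GRing.scale/= mulrCA mulVf// mulr1.
  rewrite /F; under eq_fun do rewrite mulrC.
  apply: is_deriveZ; apply: is_derive1_comp.
  rewrite -[X in is_derive _ _ _ X]addr0 -[X in is_derive _ _ _ (X + _)]mulr1.
  by apply: is_deriveD.
have cF : continuous F.
  by move=> u; apply: differentiable_continuous; apply/derivable1_diffP; apply: ex_derive.
rewrite /Rintegral (@continuous_FTC2 _ _ F)//=.
- by rewrite /F mulrBl.
- by apply: continuous_subspaceT; exact: continuous_cos_affine.
- split.
  + by move=> u _; exact: ex_derive.
  + by apply: cvg_at_right_filter; exact: cF.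
  + by apply: cvg_at_left_filter; exact: cF.
- by move=> u _; rewrite derive1E; exact: derive_val.
Qed.

End RealIntegrals.

(** * The Dirichlet kernel and Cesaro summation *)

Section DirichletKernel.
Context {R : realType}.
Local Notation mu := (@lebesgue_measure R).

Lemma sin_intpi (k : int) : sin (k%:~R * pi) = 0 :> R.
Proof.
have sn n : sin (n%:R * pi) = 0 :> R.
  elim: n => [|n IH]; first by rewrite mul0r sin0.
  by rewrite -natr1 mulrDl mul1r sinDpi IH oppr0.
by case: k => n; [exact: sn|rewrite NegzE mulrNz mulNr sinN sn oppr0].
Qed.

(* The Dirichlet kernel over the asymmetric range [- n <= k < n]. *)
Definition dirichlet (n : nat) (v : R) : R :=
  partial_sum (fun k : int => cos (k%:~R * v)) (zball n).

(** Dropping the index [n] from the symmetric range subtracts [cos (n%:R * v)], which turns the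
    usual $\sin((n+1/2)v)/\sin(v/2)$ into $\cot(v/2)\sin(nv)$. *)
Lemma sin_dirichlet n v :
  sin (v / 2) * dirichlet n v = cos (v / 2) * sin (n%:R * v).
Proof.
rewrite /dirichlet partial_sum_zball.
elim: n => [|n IH]; first by rewrite big_nil mul0r sin0 !mulr0.
rewrite big_nat_recr//= mulrDr IH NegzE mulrNz mulNr cosN -!pmulrn.
have -> : n.+1%:R * v = n%:R * v + v by rewrite -natr1 mulrDl mul1r.
set a := v / 2; have -> : v = a + a by rewrite /a; lra.
rewrite !(sinD _ (a + a), cosD _ (a + a)) sinD cosD.
set S := sin (_ * _); set C := cos (n%:R * _).
have := cos2Dsin2 a; set A := sin a; set B := cos a => h.
(* The two sides differ by a multiple of [1 - (B ^+ 2 + A ^+ 2)]. *)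
apply/eqP; rewrite -subr_eq0; apply/eqP.
transitivity ((1 - (B ^+ 2 + A ^+ 2)) * (S * B + C * A)); first by ring.
by rewrite h subrr mul0r.
Qed.

Lemma sin_sum_sin n (v : R) :
  sin (v / 2) * \sum_(j < n) sin (j.+1%:R * v) =
  (cos (v / 2) - cos (n%:R * v + v / 2)) / 2.
Proof.
elim: n => [|n IH].
  by rewrite big_ord0 mulr0 mul0r add0r subrr mul0r.
rewrite big_ord_recr/= mulrDr IH.
have -> : n.+1%:R * v = n%:R * v + v by rewrite -natr1 mulrDl mul1r.
set a := v / 2; have -> : v = a + a by rewrite /a; lra.
set b := n%:R * (a + a); have -> : b + (a + a) + a = (b + a + a) + a by ring.
have -> : b + (a + a) = (b + a + a) by ring.
rewrite [cos (b + a + a + a)]cosD [sin (b + a + a)]sinD [cos (b + a + a)]cosD.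
set S := sin (b + a); set C := cos (b + a).
have := cos2Dsin2 a; set A := sin a; set B := cos a => h.
apply/eqP; rewrite -subr_eq0; apply/eqP.
transitivity ((B ^+ 2 + A ^+ 2 - 1) * C / 2); first by field.
by rewrite h subrr !mul0r.
Qed.

Lemma sin_dirichlet_le1 n v : `|sin (v / 2) * dirichlet n v| <= 1.
Proof.
rewrite sin_dirichlet normrM -[leRHS]mulr1.
by apply: ler_pM => //; [exact: cos_max|exact: sin_max].
Qed.

Lemma sin_sum_dirichlet_le n v :
  `|sin (v / 2) * \sum_(j < n) dirichlet j.+1 v| <= n%:R.
Proof.
rewrite mulr_sumr; apply: (le_trans (ler_norm_sum _ _ _)).
rewrite -[leRHS](_ : \sum_(j < n) 1 = _); last by rewrite sumr_const card_ord.
by apply: ler_sum => j _; exact: sin_dirichlet_le1.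
Qed.

(** A second factor [sin (v / 2)] makes the sum of sines telescope, so that the bound does not grow
    with [n]. *)
Lemma sin2_sum_dirichlet_le n v :
  `|sin (v / 2) ^+ 2 * \sum_(j < n) dirichlet j.+1 v| <= 1.
Proof.
rewrite expr2 -mulrA mulr_sumr.
under eq_bigr do rewrite sin_dirichlet.
rewrite -mulr_sumr mulrCA sin_sum_sin normrM -[leRHS]mulr1.
apply: ler_pM => //; first exact: cos_max.
rewrite normrM (ger0_norm (_ : 0 <= 2^-1)) ?invr_ge0// ler_pdivrMr// mul1r.
by rewrite (le_trans (ler_normB _ _))// -[leRHS]/(1 + 1) lerD// cos_max.
Qed.

Lemma continuous_dirichlet n w : continuous (fun u => dirichlet n (u - w)).
Proof.
rewrite /dirichlet; under eq_fun do rewrite partial_sumE.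
apply: continuous_sum => k u.
have -> : (fun u => cos (k%:~R * (u - w))) =
    (fun u => cos (k%:~R * u + - (k%:~R * w))).
  by apply/funext => v; rewrite mulrBr.
exact: continuous_cos_affine.
Qed.

(** Only the index 0 contributes. It lies in [zball n.+1] but not in the empty [zball 0], hence the
    successor. *)
Lemma Rintegral_dirichlet n w :
  \int[mu]_(u in `[- pi, pi]) dirichlet n.+1 (u - w) = 2 * pi.
Proof.
have npp : - pi <= pi :> R by have := @pi_ge0 R; lra.
rewrite /dirichlet; under eq_Rintegral do rewrite partial_sumE.
have E (k : int) (u : R) :
    cos (k%:~R * (u - w)) = cos (k%:~R * u + - (k%:~R * w)) by rewrite mulrBr.
under eq_Rintegral do under eq_bigr do rewrite E.
rewrite Rintegral_sum => [||k]//; last first.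
  by apply: continuous_integrable; exact: continuous_cos_affine.
rewrite (eq_bigr (fun k : int => if k == 0 then 2 * pi else 0)); last first.
  move=> k _; rewrite Rintegral_cos_affine// intr_eq0; case: eqP => [->|_].
    by rewrite mul0r oppr0 cos0 mulr1; lra.
  rewrite mulrN !(sinD, cosD, sinN) mulNr sin_intpi.
  by rewrite !cosN; ring.
rewrite -partial_sumE partial_sum_zball big_nat_recl//= big1 => [|i _].
  by rewrite !addr0.
by rewrite addr0.
Qed.

(* The Lipschitz condition makes [(f u - f w) * E_n (u - w) / n] bounded, where
   [E_n] is the sum of the first [n] kernels; it tends to 0 pointwise because
   [sin (v / 2) ^+ 2 * E_n v] is bounded, so dominated convergence applies. *)
Lemma cesaro_dirichlet (f : R -> R) (w C : R) :
  measurable_fun setT f ->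
  (forall u, - pi <= u <= pi -> `|f u - f w| <= C * `|sin ((u - w) / 2)|) ->
  arithmetic_mean (fun n => \int[mu]_(u in `[- pi, pi])
     (f u * dirichlet n.+1 (u - w))) @ \oo --> 2 * pi * f w.
Proof.
move=> mf fC; set D := `[- pi, pi]%classic.
have mD : @measurable _ (measurableTypeR R) D by exact: measurable_itv.
pose E n v := \sum_(j < n) dirichlet j.+1 v.
pose G n u := (f u - f w) * E n.+1 (u - w) / n.+1%:R.
have cE n : continuous (fun u => E n (u - w)).
  by apply: continuous_sum => j; exact: continuous_dirichlet.
have icst (c : R) : mu.-integrable D (EFin \o cst c).
  by apply: continuous_integrable => u; exact: cvg_cst.
have fC' u : D u -> `|f u - f w| <= `|C| * `|sin ((u - w) / 2)|.
  move=> Du; apply: (le_trans (fC u _)); first by move: Du; rewrite /D/= in_itv.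
  by rewrite ler_wpM2r// ler_norm.
have G0 u : D u -> G n u @[n --> \oo] --> (0 : R).
  move=> Du; rewrite /G; set s := sin ((u - w) / 2).
  have [s0|s0] := eqVneq s 0.
    have -> : f u - f w = 0.
      by apply/eqP; rewrite -normr_le0 (le_trans (fC' _ Du))// -/s s0 normr0 mulr0.
    under eq_fun do rewrite !mul0r.
    exact: cvg_cst.
  have s0' : 0 < `|s| by rewrite normr_gt0.
  pose b n := (`|C| / `|s|) * n.+1%:R^-1.
  have b0 : b n @[n --> \oo] --> (0 : R).
    by rewrite -(mulr0 (`|C| / `|s|)); apply: cvgMr; exact: cvg_harmonic.
  apply/norm_cvg0P; apply: (squeeze_cvgr _ (cvg_cst 0) b0).
  apply: nearW => n; rewrite normr_ge0/= /b normrM normfV (ger0_norm (ler0n _ _)).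
  rewrite ler_wpM2r ?invr_ge0// normrM.
  have := sin2_sum_dirichlet_le n.+1 (u - w); rewrite -/s -/(E _ _).
  rewrite normrM normrX => h.
  apply: (le_trans (ler_wpM2r (normr_ge0 _) (fC' _ Du))); rewrite -/s.
  rewrite -mulrA ler_wpM2l//.
  by rewrite -[leRHS]mul1r ler_pdivlMr// mulrAC -expr2.
have GC n u : D u -> `|G n u| <= `|C|.
  move=> Du; rewrite /G normrM normfV (ger0_norm (ler0n _ _)).
  rewrite ler_pdivrMr// normrM.
  apply: (le_trans (ler_wpM2r (normr_ge0 _) (fC' _ Du))).
  rewrite -mulrA ler_wpM2l// -normrM.
  exact: sin_sum_dirichlet_le.
have mG n : measurable_fun D (G n).
  apply: measurable_funTS; apply: measurable_funM => //.
  apply: measurable_funM; first exact: measurable_funB.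
  exact: continuous_measurable_fun.
have [_] := Rdominated_convergence mD mG G0 (icst `|C|) GC.
rewrite Rintegral_cst// mul0r => cvgG.
(* The hypothesis at [w] also bounds [f] itself on [D], by $|f(w)|+|C|$, since a sine is at most
   1. *)
have ifd j : mu.-integrable D (EFin \o (fun u => f u * dirichlet j.+1 (u - w))).
  have ib : mu.-integrable D
      (EFin \o (fun u => (`|f w| + `|C|) * `|dirichlet j.+1 (u - w)|)).
    apply: continuous_integrable => u.
    apply: cvgM; first exact: cvg_cst.
    by apply: cvg_norm; exact: continuous_dirichlet.
  apply: le_integrable ib => //.
    apply/measurable_EFinP; apply: measurable_funTS; apply: measurable_funM => //.
    by apply: continuous_measurable_fun; exact: continuous_dirichlet.
  move=> u Du; rewrite /= lee_fin normrM [leRHS]ger0_norm ?mulr_ge0// ?addr_ge0//.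
  rewrite ler_wpM2r// -[f u](subrK (f w)) (le_trans (ler_normD _ _))// addrC lerD2l.
  apply: (le_trans (fC' _ Du)); rewrite -[leRHS]mulr1 ler_wpM2l//.
  exact: sin_max.
have id j : mu.-integrable D (EFin \o (fun u => dirichlet j.+1 (u - w))).
  by apply: continuous_integrable; exact: continuous_dirichlet.
(* Each kernel has integral [2 * pi], so subtracting [f w] inside shifts the mean by exactly the
   claimed limit. *)
have IG n : \int[mu]_(u in D) G n u =
    n.+1%:R^-1 * \sum_(j < n.+1) (\int[mu]_(u in D) (f u * dirichlet j.+1 (u - w)))
    - 2 * pi * f w.
  have iS j : mu.-integrable D
      (EFin \o (fun u => n.+1%:R^-1 * (f u * dirichlet j.+1 (u - w)
         - f w * dirichlet j.+1 (u - w)))).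
    have iB : mu.-integrable D (EFin \o (fun u => f u * dirichlet j.+1 (u - w)
         - f w * dirichlet j.+1 (u - w))).
      apply: (integrable_EFinB mD (ifd j)).
      exact: (integrable_EFinZl (f w) mD (id j)).
    exact: (integrable_EFinZl (n.+1%:R^-1) mD iB).
  transitivity (\int[mu]_(u in D) (\sum_(j < n.+1)
      n.+1%:R^-1 * (f u * dirichlet j.+1 (u - w) - f w * dirichlet j.+1 (u - w)))).
    apply: eq_Rintegral => u _; rewrite /G /E mulrC -!mulr_sumr; congr (_ * _).
    by rewrite mulr_sumr; apply: eq_bigr => j _; rewrite mulrBl.
  rewrite Rintegral_sum// (eq_bigr (fun j : 'I_n.+1 => n.+1%:R^-1 *
      ((\int[mu]_(u in D) (f u * dirichlet j.+1 (u - w))) - f w * (2 * pi)))).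
    rewrite -mulr_sumr sumrB mulrBr sumr_const card_ord; congr (_ - _).
    rewrite -(mulr_natr (f w * _)) mulrCA mulVf ?pnatr_eq0// mulr1.
    by rewrite mulrC.
  move=> j _; rewrite RintegralZl//; last first.
    apply: (integrable_EFinB mD (ifd j)).
    exact: (integrable_EFinZl (f w) mD (id j)).
  rewrite RintegralB//; last exact: (integrable_EFinZl (f w) mD (id j)).
  by rewrite RintegralZl// Rintegral_dirichlet.
apply/subr_cvg0; apply: cvg_trans cvgG; apply: near_eq_cvg; apply: nearW => n.
by rewrite IG /arithmetic_mean/= /series/= big_mkord.
Qed.

(** A convergent sequence has the limit of its Cesaro means. In the application the limit exists by
    hypothesis on the series of coefficients, and Cesaro summation identifies it. *)
Lemma dirichlet_cvg (f : R -> R) (w C L : R) :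
  measurable_fun setT f ->
  (forall u, - pi <= u <= pi -> `|f u - f w| <= C * `|sin ((u - w) / 2)|) ->
  (\int[mu]_(u in `[- pi, pi]) (f u * dirichlet n (u - w))) @[n --> \oo] --> L ->
  L = 2 * pi * f w.
Proof.
move=> mf fC fL; apply: (cvg_unique (@Rhausdorff R) _ (cesaro_dirichlet mf fC)).
by apply: cesaro; move: fL; rewrite -cvg_shiftS.
Qed.

End DirichletKernel.

(** * Fourier series of the truncated exponential *)

Section FourierCoefficients.
Context {R : realType}.
Local Notation mu := (@lebesgue_measure R).

Lemma norm_sin_le (x : R) : `|sin x| <= `|x|.
Proof.
wlog x0 : x / 0 <= x.
  move=> H; have [|x0] := leP 0 x; first exact: H.
  by rewrite -normrN -sinN -[leRHS]normrN H// oppr_ge0 ltW.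
have [y _] := @MVT_segment R sin cos 0 x x0
  (fun y _ => is_derive_sin y) (continuous_subspaceT (@continuous_sin R)).
rewrite sin0 !subr0 => ->; rewrite normrM -[leRHS]mul1r.
by rewrite ler_wpM2r// cos_max.
Qed.

Lemma norm_cosB_le (x y : R) : `|cos x - cos y| <= `|x - y|.
Proof.
have -> : cos x - cos y = - (2 * sin ((x + y) / 2) * sin ((x - y) / 2)).
  set a := (x + y) / 2; set b := (x - y) / 2.
  have -> : x = a + b by rewrite /a /b; field.
  have -> : y = a - b by rewrite /a /b; field.
  by rewrite cosD cosB; ring.
rewrite normrN !normrM ger0_norm// -mulrA.
have h1 := sin_max ((x + y) / 2); have := norm_sin_le ((x - y) / 2).
rewrite [in X in _ <= X -> _]normrM (@ger0_norm _ 2^-1) ?invr_ge0// => h2.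
have := normr_ge0 (sin ((x + y) / 2)); have := normr_ge0 (sin ((x - y) / 2)).
by move: h1 h2; set a := `|_|; set b := `|_|; set c := `|_|; nra.
Qed.

(** Up to 1 the mean value theorem applies, the derivative being at least [cos 1]; on [[1, b1]] sine
    has a positive minimum because [b1 < pi]. *)
Lemma sin_ge_linear (b : R) : 0 <= b < pi ->
  exists2 c : R, 0 < c & forall x, `|x| <= b -> c * `|x| <= `|sin x|.
Proof.
move=> /andP[b0 bpi].
have cos_lb (x : R) : 0 <= x <= 1 -> cos 1 * x <= sin x.
  move=> /andP[x0 x1].
  have [y] := @MVT_segment R sin cos 0 x x0
    (fun y _ => is_derive_sin y) (continuous_subspaceT (@continuous_sin R)).
  rewrite sin0 !subr0 in_itv/= => /andP[y0 yx] ->; rewrite ler_wpM2r//.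
  have pi2 := @pi_ge2 R.
  have [->//|y1] := eqVneq y 1.
  by rewrite ltW// ltr_cos ?in_itv/= ?lt_neqAle ?y1; lra.
have [b1 b11 bb1] : exists2 b1, 1 <= b1 < pi & b <= b1.
  exists (Num.max 1 b); last by rewrite le_max lexx orbT.
  by rewrite le_max lexx/= gt_max bpi (lt_le_trans _ (@pi_ge2 R))// ltr1n.
have [b1_ge1 b1pi] := andP b11.
have [z] := @EVT_min R sin 1 b1 b1_ge1 (continuous_subspaceT (@continuous_sin R)).
rewrite in_itv/= => /andP[z1 zb] zmin.
have sz : 0 < sin z by apply: sin_gt0_pi; apply/andP; split; lra.
exists (Num.min (cos 1) (sin z / b1)).
  by rewrite lt_min cos1_gt0 divr_gt0//; lra.
move=> x; wlog x0 : x / 0 <= x.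
  move=> H; have [|x0] := leP 0 x; first exact: H.
  by have := H (- x); rewrite sinN !normrN oppr_ge0; apply; exact: ltW.
rewrite (ger0_norm x0) => xb; apply: le_trans (ler_norm _).
have [x1|x1] := leP x 1.
  apply: le_trans (cos_lb x _); last by rewrite x0.
  by rewrite ler_wpM2r// ge_min lexx.
apply: (@le_trans _ _ (sin z)); last by apply: zmin; rewrite in_itv/=; lra.
apply: (@le_trans _ _ (sin z / b1 * x)); first by rewrite ler_wpM2r// ge_min lexx orbT.
by rewrite -mulrA ler_piMr ?(ltW sz)// mulrC ler_pdivrMr ?mul1r; lra.
Qed.

(** The integral of [cos (s * u)] over [[- c, c]]. *)
Definition sincI (c s : R) : R := if s == 0 then 2 * c else 2 * sin (c * s) / s.

Lemma sincIN c s : sincI c (- s) = sincI c s.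
Proof.
rewrite /sincI oppr_eq0; case: eqP => // _.
by rewrite mulrN sinN invrN !mulrN !mulNr opprK.
Qed.

Lemma Rintegral_cos_sym (c s p : R) : 0 <= c ->
  \int[mu]_(u in `[- c, c]) cos (s * u + p) = cos p * sincI c s.
Proof.
move=> c0; rewrite Rintegral_cos_affine; last by lra.
rewrite /sincI; case: eqVneq => s0; first by ring.
by rewrite mulrN !sinD cosN sinN (mulrC c s); field.
Qed.

(* The Fourier coefficients of the function equal to [expi (tau * u)] for
   [`|u| <= c] and to [1] elsewhere on [[- pi, pi]]. *)
Definition trunc_coef (tau c : R) (k : int) : R :=
  if k == 0 then 1 - c / pi
  else if k%:~R == tau then 1
  else tau * sin (c * k%:~R) / (pi * k%:~R * (k%:~R - tau)).

(** The subtracted [(k == 0)%:R] is the coefficient of the constant 1. At [k = tau] the right-hand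
    side is [c / pi], which agrees with the value 1 of the definition because [c = pi] there. *)
Lemma trunc_coefE (tau c : R) (k : int) : tau != 0 ->
  sin (c * tau) = 0 -> cos (c * tau) = 1 -> (k%:~R = tau -> c = pi) ->
  trunc_coef tau c k - (k == 0)%:R =
  (sincI c (tau - k%:~R) - sincI c k%:~R) / (2 * pi).
Proof.
move=> tau0 sc cc kt; have pi0 : pi != 0 :> R by rewrite gt_eqF ?pi_gt0.
rewrite /trunc_coef /sincI; move: (pi) pi0 kt => q q0 kt.
case: eqVneq => [->|k0].
  by rewrite mulr0z !subr0 (negbTE tau0) eqxx sc /=; field; rewrite q0.
have k0' : k%:~R != 0 :> R by rewrite intr_eq0.
rewrite (negbTE k0') subr0 subr_eq0 [tau == _]eq_sym.
case: eqVneq => [ktau|ktau].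
  by rewrite -ktau in sc; rewrite sc (kt ktau) mulr0 mul0r subr0 divff// mulf_neq0.
have ktau' : k%:~R - tau != 0 by rewrite subr_eq0.
have ktau'' : tau - k%:~R != 0 by rewrite subr_eq0 eq_sym.
rewrite (mulrBr c) sinB sc cc mul0r mul1r sub0r.
move: (k%:~R : R) k0' ktau' ktau'' => x x0 xt tx.
by field; rewrite q0 xt tx x0.
Qed.

(** The real part of $e^{ip}(E(u)-1)$, where $E$ is the truncated exponential; taking off the
    constant 1 leaves a function supported in [[- c, c]]. *)
Definition trunc_cos (tau c p u : R) : R :=
  if `|u| <= c then cos (tau * u + p) - cos p else 0.

Lemma measurable_trunc_cos tau c p : measurable_fun setT (trunc_cos tau c p).
Proof.
apply: measurable_fun_if => //.
- by apply: measurable_fun_ler => //; exact: measurableT_comp.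
- apply: measurable_funTS; apply: measurable_funB => //.
  by apply: continuous_measurable_fun; exact: continuous_cos_affine.
Qed.

Lemma integrable_trunc_cos (tau c p w a b : R) (k : int) :
  mu.-integrable `[a, b]
    (EFin \o (fun u => trunc_cos tau c p u * cos (k%:~R * (u - w)))).
Proof.
have i2 : mu.-integrable `[a, b] (EFin \o cst (2 : R)).
  by apply: continuous_integrable => u; exact: cvg_cst.
apply: le_integrable i2 => //.
  apply/measurable_EFinP/measurable_funTS; apply: measurable_funM.
    exact: measurable_trunc_cos.
  have -> : (fun u => cos (k%:~R * (u - w))) =
      (fun u => cos (k%:~R * u + - (k%:~R * w))).
    by apply/funext => v; rewrite mulrBr.
  by apply: continuous_measurable_fun; exact: continuous_cos_affine.
move=> u _; rewrite /= lee_fin (ger0_norm (ler0n _ 2)) normrM.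
rewrite -[leRHS]mulr1; apply: ler_pM => //; last exact: cos_max.
rewrite /trunc_cos; case: ifP => _; last by rewrite normr0.
by rewrite (le_trans (ler_normB _ _))// -[leRHS]/(1 + 1) lerD// cos_max.
Qed.

(** Inside [[- c, c]] the cosine has Lipschitz constant $|\tau|$; outside, [u] is at least $c-|w|$
    away from [w] while the values differ by at most 2. Finally $|u-w|/2\le(\pi+|w|)/2<\pi$ allows
    the distance to be replaced by the sine. *)
Lemma trunc_cos_lipschitz (tau c p w : R) : `|w| < c <= pi ->
  exists C, forall u, - pi <= u <= pi ->
    `|trunc_cos tau c p u - trunc_cos tau c p w| <= C * `|sin ((u - w) / 2)|.
Proof.
move=> /andP[wc cpi].
have [|d d0 hd] := @sin_ge_linear ((pi + `|w|) / 2).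
  by have := normr_ge0 w; have := @pi_gt0 R; lra.
pose K := `|tau| + 2 / (c - `|w|).
have K0 : 0 <= K by rewrite addr_ge0// divr_ge0//; lra.
exists (K * (2 / d)) => u up.
have h1 : `|trunc_cos tau c p u - trunc_cos tau c p w| <= K * `|u - w|.
  rewrite /trunc_cos (ltW wc); case: ifPn => [uc|]; last rewrite -ltNge => uc.
    have := norm_cosB_le (tau * u + p) (tau * w + p).
    rewrite [_ - (tau * w + p)](_ : _ = tau * (u - w)); last by ring.
    rewrite normrM (_ : _ - cos p - _ = cos (tau * u + p) - cos (tau * w + p)); last by ring.
    move=> /le_trans; apply; rewrite ler_wpM2r// lerDl divr_ge0//; lra.
  rewrite sub0r normrN; apply: (@le_trans _ _ 2).
    by rewrite (le_trans (ler_normB _ _))// -[leRHS]/(1 + 1) lerD// cos_max.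
  apply: (@le_trans _ _ (2 / (c - `|w|) * `|u - w|)); last first.
    by rewrite ler_wpM2r// lerDr.
  rewrite mulrAC ler_pdivlMr; last by lra.
  rewrite ler_wpM2l//; have := lerB_dist u w; lra.
apply: (le_trans h1); rewrite -mulrA ler_wpM2l//.
have := hd ((u - w) / 2) _; rewrite normrM (@ger0_norm _ 2^-1) ?invr_ge0//.
move=> h; rewrite mulrAC ler_pdivlMr//.
have {h} : d * (`|u - w| / 2) <= `|sin ((u - w) / 2)|.
  apply: h; rewrite ler_wpM2r ?invr_ge0//.
  apply: (le_trans (ler_normB _ _)); rewrite lerD2r ler_norml; lra.
by lra.
Qed.

(** The factor [cos (k%:~R * (u - w))] is half the sum of the characters of indices [k] and [- k],
    so both coefficients occur. *)
Lemma Rintegral_trunc_cos (tau c p w : R) (k : int) : 0 < c <= pi -> tau != 0 ->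
  sin (c * tau) = 0 -> cos (c * tau) = 1 -> (forall k : int, k%:~R = tau -> c = pi) ->
  let s k := (trunc_coef tau c k - (k == 0)%:R) * cos (k%:~R * w + p) in
  \int[mu]_(u in `[- pi, pi]) (trunc_cos tau c p u * cos (k%:~R * (u - w))) =
  pi * (s k + s (- k)).
Proof.
move=> /andP[c0 cpi] tau0 sc cc kt s.
transitivity (\int[mu]_(u in `[- pi, pi])
   ((fun u => (cos (tau * u + p) - cos p) * cos (k%:~R * (u - w))) \_ `[- c, c]) u).
  apply: eq_Rintegral => u _; rewrite /trunc_cos patchE mem_setE in_itv/= -ler_norml.
  by case: ifP => // _; rewrite mul0r.
rewrite -Rintegral_mkcondr setIidr; last first.
  by apply: subset_itv; rewrite bnd_simp; lra.
set K := k%:~R : R.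
transitivity (\int[mu]_(u in `[- c, c])
  (2^-1 * (cos ((tau + K) * u + (p - K * w)) + cos ((tau - K) * u + (p + K * w)))
   - cos p * cos (K * u + - (K * w)))).
  apply: eq_Rintegral => u _.
  have -> : (tau + K) * u + (p - K * w) = (tau * u + p) + (K * u - K * w) by ring.
  have -> : (tau - K) * u + (p + K * w) = (tau * u + p) - (K * u - K * w) by ring.
  rewrite [K * (u - w)]mulrBr (cosD (tau * u + p)) (cosB (tau * u + p)).
  by set a := cos (tau * u + p); set b := cos (K * u - K * w); field.
have ic a b : mu.-integrable `[- c, c] (EFin \o (fun u => cos (a * u + b))).
  by apply: continuous_integrable; exact: continuous_cos_affine.
have mcc : @measurable _ (measurableTypeR R) `[- c, c] by exact: measurable_itv.
rewrite RintegralB//; last 2 first.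
- apply: continuous_integrable => u; apply: cvgM; first exact: cvg_cst.
  by apply: cvgD; exact: continuous_cos_affine.
- exact: (integrable_EFinZl _ mcc (ic _ _)).
rewrite !RintegralZl//; last first.
  by apply: continuous_integrable => u; apply: cvgD; exact: continuous_cos_affine.
rewrite RintegralD// !Rintegral_cos_sym ?(ltW c0)// cosN.
have tE := fun k => trunc_coefE tau0 sc cc (kt k).
rewrite /s !tE mulrNz opprK sincIN.
rewrite -/K mulNr -[p - _]opprB cosN [cos (- (K * w) + p)]cosD cosN.
have -> : cos (K * w + p) = cos p * cos (K * w) - sin p * sin (K * w).
  by rewrite addrC cosD.
rewrite (_ : K * w - p = - (p - K * w)); last by ring.
rewrite cosN cosB cosD sinN.
have pi0 : pi != 0 :> R by rewrite gt_eqF ?pi_gt0.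
by move: (pi) pi0 => q q0; field.
Qed.

Lemma trunc_coef_series (tau c p w L : R) : `|w| < c <= pi -> tau != 0 ->
  sin (c * tau) = 0 -> cos (c * tau) = 1 -> (forall k : int, k%:~R = tau -> c = pi) ->
  partial_sum (fun k : int => trunc_coef tau c k * cos (k%:~R * w + p)) @ totally --> L ->
  L = cos (tau * w + p).
Proof.
move=> wc tau0 sc cc kt sL.
pose s (k : int) := (trunc_coef tau c k - (k == 0)%:R) * cos (k%:~R * w + p).
have c0 : 0 < c <= pi by have := normr_ge0 w; lra.
have [C hC] := @trunc_cos_lipschitz tau c p w wc.
(* Removing the coefficient of the constant 1 lowers the limit by [cos p]. This is stated for every
   exhausting sequence, as two of them are used. *)
have s'L (A_ : nat -> {fset int}) : (forall k, \forall n \near \oo, k \in A_ n) ->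
    partial_sum s (A_ n) @[n --> \oo] --> L - cos p.
  move=> hA; have := cvg_totally_comp sL hA => h.
  have : partial_sum (fun k : int => trunc_coef tau c k * cos (k%:~R * w + p))
      (A_ n) - cos p @[n --> \oo] --> L - cos p by apply: cvgB => //; exact: cvg_cst.
  apply: cvg_trans; apply: near_eq_cvg; near=> n.
  rewrite !partial_sumE [in RHS](eq_bigr (fun k : int => trunc_coef tau c k * cos (k%:~R * w + p)
    - (k == 0)%:R * cos (k%:~R * w + p))); last first.
    by move=> k _; rewrite -mulrBl.
  rewrite sumrB; congr (_ - _).
  have A0 : 0 \in A_ n by near: n; exact: hA.
  rewrite (big_fsetD1 0)//= mul0r add0r mul1r big_seq big1 ?addr0// => k.
  by rewrite in_fsetD1 => /andP[/negbTE-> _]; rewrite mul0r.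
have := dirichlet_cvg (measurable_trunc_cos tau c p) hC.
move=> /(_ (pi * ((L - cos p) + (L - cos p)))).
rewrite {2}/trunc_cos; case/andP: wc => /ltW wc cpi; rewrite wc.
move=> H; have {}H : pi * (L - cos p + (L - cos p)) = 2 * pi * (cos (tau * w + p) - cos p).
  apply: H.
  (* As [zball n] is not symmetric, the terms [s (- k)] are summed over its reflection, which also
     exhausts [int]. *)
  pose zN n := seq_fset tt (map -%R (zball n)).
  have : pi * (partial_sum s (zball n) + partial_sum s (zN n)) @[n --> \oo] -->
      pi * (L - cos p + (L - cos p)).
    apply: cvgM; first exact: cvg_cst.
    apply: cvgD; apply: s'L => k; first exact: near_zball.
    have := near_zball (- k); apply: filterS => n kn.
    by rewrite seq_fsetE -[k]opprK map_f.
  apply: cvg_trans; apply: near_eq_cvg; apply: nearW => n.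
  rewrite (@partial_sum_seq_fset _ _ _ (map -%R _)); last first.
    by rewrite map_inj_uniq ?fset_uniq//; exact: oppr_inj.
  rewrite partial_sumE big_map -big_split/= mulr_sumr.
  rewrite (eq_bigr (fun k => \int[mu]_(u in `[- pi, pi])
     (trunc_cos tau c p u * cos (k%:~R * (u - w))))); last first.
    by move=> k _; rewrite Rintegral_trunc_cos.
  rewrite -Rintegral_sum//; last exact: integrable_trunc_cos.
  apply: eq_Rintegral => u _.
  by rewrite /dirichlet partial_sumE mulr_sumr.
have pi0 := @pi_gt0 R.
apply/eqP; rewrite -subr_eq0; apply/eqP; apply: (mulfI (x := 2 * pi)).
  by rewrite gt_eqF// mulr_gt0.
by rewrite mulr0; lra.
Unshelve. all: by end_near. Qed.

End FourierCoefficients.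

(** * Termwise integration of a series *)

Section SeriesIntegral.
Context d {T : measurableType d} {R : realType} (mu : {measure set T -> \bar R}).

(** By monotone convergence the series of absolute values is integrable, and it dominates all
    partial sums. *)
Lemma Rintegral_series (D : set T) (F_ : (T -> R)^nat) (F : T -> R) (M : R) :
  measurable D -> (forall i, mu.-integrable D (EFin \o F_ i)) ->
  (forall n, \sum_(0 <= i < n) \int[mu]_(x in D) `|F_ i x| <= M) ->
  (forall x, D x -> \sum_(0 <= i < n) F_ i x @[n --> \oo] --> F x) ->
  mu.-integrable D (EFin \o F) /\
  \sum_(0 <= i < n) \int[mu]_(x in D) F_ i x @[n --> \oo] -->
    \int[mu]_(x in D) F x.
Proof.
move=> mD iF FM FF.
have mF_ i : measurable_fun D (F_ i).
  by apply/measurable_EFinP; exact: (measurable_int mu).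
pose S n x := \sum_(0 <= i < n) F_ i x.
have mS n : measurable_fun D (S n) by exact: measurable_sum.
have mF : measurable_fun D F by exact: measurable_fun_cvg FF.
(* The majorant may be infinite at some points, so it is kept in the extended reals. *)
pose h x := (\sum_(i <oo) (`|F_ i x|%:E))%E.
have mnF i : measurable_fun D (fun x => (`|F_ i x|)%:E).
  by apply/measurable_EFinP; exact: measurableT_comp.
have h0 x : (0 <= h x)%E by apply: nneseries_ge0 => n _ _; rewrite lee_fin.
have ih : mu.-integrable D h.
  apply/integrableP; split.
    by apply: ge0_emeasurable_sum.
  under eq_integral do rewrite gee0_abs//.
  rewrite integral_nneseries//.
  apply: (@le_lt_trans _ _ M%:E); last exact: ltry.
  apply: lime_le.
    apply: is_cvg_nneseries => n _ _; apply: integral_ge0 => x _.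
    by rewrite lee_fin.
  apply: nearW => n; rewrite (eq_bigr (fun i => (\int[mu]_(x in D) `|F_ i x|)%:E)).
    by rewrite sumEFin lee_fin.
  move=> i _; rewrite /Rintegral fineK//; apply: integrable_fin_num => //.
  exact: (integrable_norm (iF i)).
have [||||| iFF _ cvgF] := @dominated_convergence _ _ _ mu D mD
    (fun n => EFin \o S n) (EFin \o F) h.
- by move=> n; exact/measurable_EFinP/mS.
- exact/measurable_EFinP.
- by apply: aeW => x Dx; apply: cvg_EFin; [exact: nearW|exact: FF].
- exact: ih.
- apply: aeW => x n Dx; rewrite /= /S.
  apply: (@le_trans _ _ (\sum_(0 <= i < n) `|F_ i x|)%:E).
    by rewrite lee_fin ler_norm_sum.
  rewrite -sumEFin.
  by apply: (@nneseries_lim_ge _ (fun i => (`|F_ i x|)%:E)) => i _ _; rewrite lee_fin.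
split => //.
have : fine (\int[mu]_(x in D) (S n x)%:E)%E @[n --> \oo] --> \int[mu]_(x in D) F x.
  by apply: fine_cvg; rewrite fineK//; exact: integrable_fin_num.
apply: cvg_trans; apply: near_eq_cvg; apply: nearW => n.
by rewrite -Rintegral_sum.
Qed.

End SeriesIntegral.

(** * Combs of short intervals and the test functions *)

Section Comb.
Context {R : realType}.
Local Notation mu := (@lebesgue_measure R).
Implicit Types (a : int -> R) (e : R) (k : int).

Definition tooth a e k (s : R) : R := if k%:~R <= s <= k%:~R + e then a k else 0.

(* [sum_k a k * \1_[k, k + e]], whose terms outside this finite set vanish at
   [s] when [e <= 1]. *)
Definition comb a e (s : R) : R :=
  partial_sum (fun k => tooth a e k s) (zball (Num.bound `|s|)).

Lemma tooth_eq0 a e k (s : R) (n : nat) : e <= 1 -> `|s| < n%:R -> k \notin zball n ->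
  tooth a e k s = 0.
Proof.
move=> e1 sn; rewrite in_zball negb_and -ltNge -leNgt /tooth => kn.
case: ifPn => // /andP[ks ske]; exfalso; move: sn; rewrite ltr_norml => /andP[ns sn].
case/orP: kn => kn.
  (* The tooth at [k] has length at most 1, so it ends by [- n], strictly below [s]. *)
  have : k + 1 <= - n%:Z by lia.
  rewrite -(@ler_int R) mulrNz intrD -pmulrn; lra.
by move: kn; rewrite -(@ler_int R) -pmulrn; lra.
Qed.

Lemma tooth_cvg a e (s : R) : e <= 1 ->
  \forall n \near \oo, partial_sum (fun k => tooth a e k s) (zball n) = comb a e s.
Proof.
move=> e1; exists (Num.bound `|s|) => // n /= sn.
rewrite (partial_sum_fsetD _ (le_zball sn)) [X in _ + X](_ : _ = 0) ?addr0//.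
rewrite partial_sumE big_seq big1// => k; rewrite inE => /andP[kn _].
by apply: tooth_eq0 kn => //; exact: archi_boundP.
Qed.

Lemma measurable_tooth a e k : measurable_fun setT (tooth a e k).
Proof.
rewrite (_ : tooth a e k = (cst (a k)) \_ `[k%:~R, k%:~R + e]).
  by apply/(measurable_restrictT _ _).1.
by apply/funext => s; rewrite patchE mem_setE in_itv.
Qed.

Lemma mul_toothE (f : R -> R) a e k : (fun s => f s * tooth a e k s) =
  (fun s => a k * f s) \_ `[k%:~R, k%:~R + e].
Proof.
apply/funext => s; rewrite patchE mem_setE in_itv/= /tooth.
by case: ifP => _; [exact: mulrC|exact: mulr0].
Qed.

Lemma integrable_mul_tooth (f : R -> R) a e k : continuous f ->
  mu.-integrable setT (EFin \o (fun s => f s * tooth a e k s)).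
Proof.
move=> cf; rewrite mul_toothE -restrict_EFin.
apply: (integrable_mkcond _ _).1 => //; apply: continuous_integrable => s.
by apply: cvgM; [exact: cvg_cst|exact: cf].
Qed.

Lemma Rintegral_mul_tooth (f : R -> R) a e k : continuous f ->
  \int[mu]_s (f s * tooth a e k s) = a k * \int[mu]_(s in `[k%:~R, k%:~R + e]) f s.
Proof.
move=> cf; rewrite mul_toothE -Rintegral_mkcond RintegralZl//.
exact: continuous_integrable.
Qed.

Lemma sqrt_growth (r s : R) : r <= s <= r + 1 ->
  Num.sqrt (1 + `|s|) <= 2 * Num.sqrt (1 + `|r|).
Proof.
move=> rs; have -> : 2 = Num.sqrt (2 ^+ 2) :> R by rewrite sqrtr_sqr ger0_norm.
rewrite -sqrtrM// ler_wsqrtr//.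
have : `|s| <= `|r| + 1.
  rewrite -[s](subrK r) (le_trans (ler_normD _ _))// addrC lerD2l.
  by rewrite ger0_norm; lra.
by have := normr_ge0 r; rewrite expr2; lra.
Qed.

Lemma Rintegral_growth (f : R -> R) C (r e : R) : continuous f ->
  (forall s, `|f s| <= C * Num.sqrt (1 + `|s|)) -> 0 <= C -> 0 <= e <= 1 ->
  \int[mu]_(s in `[r, r + e]) `|f s| <= 2 * C * Num.sqrt (1 + `|r|) * e.
Proof.
move=> cf fC C0 /andP[e0 e1]; set B := 2 * C * _.
apply: (@le_trans _ _ (\int[mu]_(s in `[r, r + e]) B)).
  apply: le_Rintegral => //.
  - by apply: continuous_integrable => s; apply: cvg_norm; exact: cf.
  - by apply: continuous_integrable => s; exact: cvg_cst.
  - move=> s; rewrite /= in_itv/= => rs; apply: (le_trans (fC s)).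
    have -> : B = C * (2 * Num.sqrt (1 + `|r|)) by rewrite /B; ring.
    rewrite ler_wpM2l//; apply: sqrt_growth; lra.
rewrite Rintegral_cst//= lebesgue_measure_itv/= lte_fin.
case: ifPn => re; first by rewrite -EFinD/= addrC addKr.
by rewrite mulr0 mulr_ge0// /B !mulr_ge0// sqrtr_ge0.
Qed.

(** The integral of $|f|$ over the tooth at [k] is at most a constant times $\sqrt{1+|k|}$, so the
    bound [M] controls the total mass and the series can be integrated termwise. *)
Lemma Rintegral_mul_comb (f : R -> R) a e C M : continuous f ->
  (forall s, `|f s| <= C * Num.sqrt (1 + `|s|)) -> 0 <= C -> 0 <= e <= 1 ->
  (forall A, partial_sum (fun k => `|a k| * Num.sqrt (1 + `|k%:~R|)) A <= M) ->
  mu.-integrable setT (EFin \o (fun s => f s * comb a e s)) /\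
  partial_sum (fun k => a k * \int[mu]_(s in `[k%:~R, k%:~R + e]) f s) (zball n)
    @[n --> \oo] --> \int[mu]_s (f s * comb a e s).
Proof.
move=> cf fC C0 e01 aM; have [e0 e1] := andP e01.
have it k := integrable_mul_tooth a e k cf.
have cnf : continuous (fun s => `|f s|) by move=> s; apply: cvg_norm; exact: cf.
have nt k : \int[mu]_s `|f s * tooth a e k s| <=
    2 * C * e * (`|a k| * Num.sqrt (1 + `|k%:~R|)).
  rewrite (_ : (fun s => _) = (fun s => `|f s| * tooth (fun k => `|a k|) e k s)); last first.
    apply/funext => s; rewrite normrM /tooth; case: ifP => //.
    by rewrite normr0.
  rewrite Rintegral_mul_tooth//.
  have := ler_wpM2l (normr_ge0 (a k)) (Rintegral_growth k%:~R cf fC C0 e01).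
  by move=> /le_trans; apply; rewrite le_eqVlt; apply/orP; left; apply/eqP; ring.
pose F_ i s := f s * (tooth a e (Posz i) s + tooth a e (Negz i) s).
have iF i : mu.-integrable setT (EFin \o F_ i).
  have := integrableD measurableT (it (Posz i)) (it (Negz i)).
  by apply: eq_integrable => // s _; rewrite /F_ /= mulrDr EFinD.
have FM n : \sum_(0 <= i < n) \int[mu]_s `|F_ i s| <= 2 * C * e * M.
  apply: le_trans (ler_wpM2l _ (aM (zball n))); last by rewrite !mulr_ge0.
  rewrite partial_sum_zball mulr_sumr; apply: ler_sum => i _.
  rewrite mulrDr; apply: le_trans (lerD (nt (Posz i)) (nt (Negz i))).
  rewrite -RintegralD//; last 2 first.
  - exact: (integrable_norm (it _)).
  - exact: (integrable_norm (it _)).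
  apply: le_Rintegral => //.
  - exact: (integrable_norm (iF i)).
  - have := integrableD measurableT (integrable_norm (it (Posz i)))
      (integrable_norm (it (Negz i))).
    by apply: eq_integrable => // s _; rewrite /= EFinD.
  - by move=> s _; rewrite /F_ mulrDr ler_normD.
have FF s : setT s -> \sum_(0 <= i < n) F_ i s @[n --> \oo] --> f s * comb a e s.
  move=> _; apply: cvg_near_cst.
  have := tooth_cvg a s e1; apply: filterS => n <-.
  by rewrite partial_sum_zball mulr_sumr.
have [iFc] := Rintegral_series measurableT iF FM FF.
split => //; apply: cvg_trans b; apply: near_eq_cvg; apply: nearW => n.
rewrite partial_sum_zball; apply: eq_bigr => i _.
rewrite -!Rintegral_mul_tooth// -RintegralD//.
by apply: eq_Rintegral => s _; rewrite /F_ mulrDr.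
Qed.

(* The function whose orthogonality to the signal, in the limit [e --> 0], is
   the sampling formula. *)
Definition test_fun (t : R) a e (s : R) : R :=
  (if t <= s <= t + e then 1 else 0) - comb a e s.

Lemma measurable_comb a e : e <= 1 -> measurable_fun setT (comb a e).
Proof.
move=> e1; apply: (@measurable_fun_cvg _ _ _ _
    (fun n s => partial_sum (fun k => tooth a e k s) (zball n))).
  move=> n; under eq_fun do rewrite partial_sumE.
  by apply: measurable_sum => k; exact: measurable_tooth.
move=> s _; apply: cvg_near_cst; exact: tooth_cvg.
Qed.

Lemma measurable_test_fun t a e : e <= 1 -> measurable_fun setT (test_fun t a e).
Proof.
move=> e1; apply: measurable_funB; last exact: measurable_comb.
rewrite (_ : (fun s => _) = (cst (1 : R)) \_ `[t, t + e]).
  by apply/(measurable_restrictT _ _).1.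
by apply/funext => s; rewrite patchE mem_setE in_itv.
Qed.

(** Read in both directions: for a cosine the sum is known and the last integral is found to vanish;
    for the signal that integral vanishes and the sum is found. *)
Lemma Rintegral_mul_test_fun (f : R -> R) t a e C M : continuous f ->
  (forall s, `|f s| <= C * Num.sqrt (1 + `|s|)) -> 0 <= C -> 0 <= e <= 1 ->
  (forall A, partial_sum (fun k => `|a k| * Num.sqrt (1 + `|k%:~R|)) A <= M) ->
  mu.-integrable setT (EFin \o (fun s => f s * test_fun t a e s)) /\
  partial_sum (fun k => a k * \int[mu]_(s in `[k%:~R, k%:~R + e]) f s) (zball n)
    @[n --> \oo] --> \int[mu]_(s in `[t, t + e]) f s
     - \int[mu]_s (f s * test_fun t a e s).
Proof.
move=> cf fC C0 e01 aM.
have [ic cc] := Rintegral_mul_comb cf fC C0 e01 aM.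
pose h s : R := f s * (if t <= s <= t + e then 1 else 0).
have hE : h = f \_ `[t, t + e].
  apply/funext => s; rewrite patchE mem_setE in_itv/= /h.
  by case: ifP => _; rewrite ?mulr1 ?mulr0.
have ih : mu.-integrable setT (EFin \o h).
  rewrite hE -restrict_EFin.
  by apply: (integrable_mkcond _ _).1 => //; exact: continuous_integrable.
have E : (fun s => f s * test_fun t a e s) = (fun s => h s - f s * comb a e s).
  by apply/funext => s; rewrite -mulrBr.
rewrite E; split; first exact: integrable_EFinB.
rewrite RintegralB// hE -Rintegral_mkcond opprB addrC subrK.
exact: cc.
Qed.

End Comb.

(** * Reindexing and limits of unordered sums *)

Section Tannery.
Context {R : realType}.

Lemma cvg_partial_sum_reindex {I : choiceType} (u : I -> R) (h h' : I -> I) (l : R) :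
  cancel h h' -> cancel h' h ->
  partial_sum u @ totally --> l -> partial_sum (u \o h) @ totally --> l.
Proof.
move=> hK h'K ul.
pose F (A : {fset I}) : {fset I} := seq_fset tt (map h A).
have FE A : partial_sum u (F A) = partial_sum (u \o h) A.
  rewrite partial_sum_seq_fset; last first.
    by rewrite map_inj_uniq ?fset_uniq//; exact: can_inj hK.
  by rewrite big_map partial_sumE.
have -> : partial_sum (u \o h) = partial_sum u \o F by apply/funext => A; rewrite /= FE.
apply: cvg_comp ul => P [A _ AP].
apply: (@near_totally _ (seq_fset tt (map h' A))) => B hB; apply: AP => /=.
apply/fsubsetP => k kA; rewrite seq_fsetE -[k]h'K map_f//.
by apply: (fsubsetP hB); rewrite seq_fsetE map_f.
Qed.

Lemma partial_sum_lim_le {I : choiceType} (u v : I -> R) (l e : R) (A : {fset I}) :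
  (forall k, `|u k| <= v k) ->
  (forall B, [disjoint A & B]%fset -> partial_sum v B <= e) ->
  partial_sum u @ totally --> l -> `|l - partial_sum u A| <= e.
Proof.
move=> uv vA ul.
have h : `|partial_sum u B - partial_sum u A| @[B --> totally] --> `|l - partial_sum u A|.
  by apply: cvg_norm; apply: cvgB => //; exact: cvg_cst.
apply: (cvgr_to_le h).
apply: (@near_totally _ A) => B AB.
rewrite (partial_sum_fsetD _ AB) addrC addKr.
apply: (le_trans (ler_norm_partial_sum _ _)).
apply: (le_trans (ler_partial_sum (v := v) _)) => //.
apply: vA; rewrite fdisjoint_sym; apply/fdisjointP => k.
by rewrite inE => /andP[].
Qed.

(** Outside a finite set [A] the majorant [v] leaves at most [e / 4], uniformly in [j]; on [A]
    termwise convergence is enough. *)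
Lemma tannery {I : choiceType} (u_ : nat -> I -> R) (u v : I -> R) (M : R)
    (S_ : nat -> R) (S : R) :
  (forall A, partial_sum v A <= M) ->
  (forall j k, `|u_ j k| <= v k) ->
  (forall k, u_ j k @[j --> \oo] --> u k) ->
  (forall j, partial_sum (u_ j) @ totally --> S_ j) ->
  partial_sum u @ totally --> S -> S_ j @[j --> \oo] --> S.
Proof.
move=> vM uv uu SS uS.
have v0 k : 0 <= v k by apply: le_trans (uv 0%N k).
have uv' k : `|u k| <= v k.
  apply: (@cvgr_to_le _ _ _ _ _ _ _ (cvg_norm (uu k))).
  by apply: nearW => j; exact: uv.
apply/cvgrPdist_le => e e0.
have e40 : 0 < e / 4 by lra.
have [|A hA] := @partial_sum_tail _ _ v M _ e40.
  by move=> B; rewrite (_ : (fun _ => _) = v)//; apply/funext => k; rewrite ger0_norm.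
have {}hA B : [disjoint A & B]%fset -> partial_sum v B <= e / 4.
  by move=> /hA; rewrite (_ : (fun _ => _) = v)//; apply/funext => k; rewrite ger0_norm.
have fin : partial_sum (u_ j) A @[j --> \oo] --> partial_sum u A.
  have -> : (fun j => partial_sum (u_ j) A) = (fun j => \sum_(k <- A) u_ j k).
    by apply/funext => j; rewrite partial_sumE.
  rewrite partial_sumE; elim: (enum_fset A) => [|k s IH].
    by under eq_fun do rewrite big_nil; rewrite big_nil; exact: cvg_cst.
  rewrite big_cons; under eq_fun do rewrite big_cons.
  by apply: cvgD.
have h1 := partial_sum_lim_le uv' hA uS.
near=> j.
have h2 := partial_sum_lim_le (uv j) hA (SS j).
have h3 : `|partial_sum u A - partial_sum (u_ j) A| <= e / 4.
  by near: j; move/cvgrPdist_le : fin => /(_ _ e40).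
move: h1 h2 h3; set a := partial_sum _ _; set b := partial_sum _ _.
by rewrite !ler_norml; lra.
Unshelve. all: by end_near. Qed.

End Tannery.

(** * Decay of the sampling coefficients and their cosine series *)

Section Coefficients.
Context {R : realType}.
Implicit Types (N : nat) (g : R -> R) (t : R) (k : int).

Lemma zball_far (K : nat) k : k \notin zball K -> K%:R <= `|k%:~R : R|.
Proof.
rewrite in_zball => kK; rewrite -intr_norm pmulrn ler_int.
by move: kK; case: k => n /=; lia.
Qed.

(** Beyond [K] the index [k] is at distance at least $(1+|k|)/2$ from both [m] and [t], whence the
    4; the numerator is at most [N + 1], as $t-m<N+1$. The bound depends on [t] only through [T],
    which gives the uniform convergence. *)
Lemma coef_bound N g (T t : R) (K : nat) k : `|t| <= T ->
  2 * (T + N%:R + 2) <= K%:R -> k \notin zball K ->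
  `|coef N g k t| * Num.sqrt (1 + `|k%:~R|) <= 4 * (N%:R + 1) * zweight k.
Proof.
move=> tT TK /zball_far Kk.
set m := Num.floor (t - N%:R).
have m1 : m%:~R <= t - N%:R by exact: floor_le_tmp.
have m2 : t - N%:R < m%:~R + 1 by rewrite -intrD1; exact: floorD1_gt.
have N0 : 0 <= N%:R :> R by [].
have tT' : - T <= t <= T by rewrite -ler_norml.
have km : (1 + `|k%:~R|) / 2 <= `|k%:~R - m%:~R : R|.
  have h : `|m%:~R : R| <= T + N%:R + 1 by rewrite ler_norml; lra.
  have := lerB_dist (k%:~R : R) m%:~R; lra.
have kt : (1 + `|k%:~R|) / 2 <= `|k%:~R - t|.
  by have := lerB_dist (k%:~R : R) t; lra.
have k1 : 1 <= 1 + `|k%:~R| :> R by rewrite lerDl.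
rewrite /coef -/m ifF; last first.
  by apply/eqP => e; move: km; rewrite e subrr normr0; have := normr_ge0 (m%:~R : R); lra.
rewrite ifF; last first.
  by apply/eqP => e; move: kt; rewrite e subrr normr0; have := normr_ge0 t; lra.
set q := 1 + `|k%:~R| in km kt k1 *.
have q0 : 0 < q by lra.
have s0 : 0 < Num.sqrt q by rewrite sqrtr_gt0.
have -> : zweight k = Num.sqrt q / q ^+ 2.
  have sq : Num.sqrt q ^+ 2 = q by rewrite sqr_sqrtr ?ltW.
  rewrite /zweight -/q; move: s0 sq; set s := Num.sqrt q => s0 <-.
  by field; rewrite gt_eqF.
rewrite [leRHS](_ : _ = 4 * (N%:R + 1) / q ^+ 2 * Num.sqrt q); last by ring.
rewrite ler_wpM2r ?(ltW s0)// normrM normfV !normrM intrD mulrNz.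
have pi1 : 1 <= `|pi| :> R.
  by rewrite ger0_norm ?pi_ge0// (le_trans _ (@pi_ge2 R))// ler1n.
have tm : `|t - m%:~R| <= N%:R + 1 by rewrite ler_norml; lra.
have q2 : 0 < q / 2 by rewrite divr_gt0.
have den : (q / 2) * (q / 2) <= `|pi| * `|k%:~R - m%:~R| * `|k%:~R - t|.
  apply: ler_pM => //; try exact: ltW.
  rewrite -[leLHS]mul1r; apply: ler_pM => //; exact: ltW.
rewrite ler_pdivrMr; last by apply: lt_le_trans den; rewrite mulr_gt0.
apply: (@le_trans _ _ (N%:R + 1)).
  rewrite -[leRHS]mulr1; apply: ler_pM => //; exact: sin_max.
apply: (@le_trans _ _ (4 * (N%:R + 1) / q ^+ 2 * (q / 2 * (q / 2)))).
  by rewrite le_eqVlt; apply/orP; left; apply/eqP; field; rewrite gt_eqF.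
by rewrite ler_wpM2l// divr_ge0 ?exprn_ge0 ?mulr_ge0 ?addr_ge0// ltW.
Qed.

Lemma bounded_partial_sum (u : int -> R) (D : R) (K : nat) :
  (0 < K)%N -> 0 <= D -> (forall k, 0 <= u k) ->
  (forall k, k \notin zball K -> u k <= D * zweight k) ->
  forall A, partial_sum u A <= partial_sum u (zball K) + D * (4 / Num.sqrt K%:R).
Proof.
move=> K0 D0 u0 uD A.
have AKK : (zball K `<=` A `|` zball K)%fset by exact: fsubsetUr.
apply: (@le_trans _ _ (partial_sum u (A `|` zball K)%fset)).
  rewrite (partial_sum_fsetD _ (fsubsetUl A (zball K))) lerDl.
  exact: partial_sum_ge0.
rewrite (partial_sum_fsetD _ AKK) lerD2l.
apply: (@le_trans _ _ (partial_sum (fun k => D * zweight k) ((A `|` zball K) `\` zball K)%fset)).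
  by apply: ler_partial_sum => k; rewrite inE => /andP[/uD].
rewrite !partial_sumE -mulr_sumr ler_wpM2l// -partial_sumE.
apply: partial_sum_zweight => //; apply/fdisjointP => k.
by rewrite inE => /andP[].
Qed.

Lemma coefE N g t k : let m := Num.floor (t - N%:R) in
  coef N g k t = trunc_coef (t - m%:~R) (g t) (k - m).
Proof.
move=> m; rewrite /coef /trunc_coef -/m subr_eq0; case: eqP => // _.
rewrite intrD mulrNz (inj_eq (addIr _)); case: eqP => // _.
by congr (_ / (_ * _)); ring.
Qed.

Lemma coef_series N g (w W p t L : R) : (0 < N)%N -> ~~ odd N -> periodic g 1 ->
  (forall t, N%:R <= t < N%:R + 1 -> g t = pi * N%:R / t) ->
  0 < W < pi -> W / (pi - W) < N%:R -> - W < w < W ->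
  partial_sum (fun k => coef N g k t * cos (k%:~R * w + p)) @ totally --> L ->
  L = cos (t * w + p).
Proof.
move=> N0 Nodd gper gN /andP[W0 Wpi] WN wW aL.
set m := Num.floor (t - N%:R).
have m1 : m%:~R <= t - N%:R by exact: floor_le_tmp.
have m2 : t - N%:R < m%:~R + 1 by rewrite -intrD1; exact: floorD1_gt.
pose tau := t - m%:~R.
have tauN : N%:R <= tau < N%:R + 1 by rewrite /tau; lra.
have gt : g t = pi * N%:R / tau.
  rewrite -gN//.
  have gz (z : int) u : g (u + z%:~R) = g u.
    have gn (n : nat) v : g (v + n%:R) = g v.
      by elim: n v => [|n IH] v; rewrite ?addr0// -natr1 addrA gper.
    by case: z => n; [exact: gn|rewrite NegzE mulrNz -(gn n.+1) subrK].
  by rewrite /tau -mulrNz gz.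
have NR : 0 < N%:R :> R by rewrite ltr0n.
have tau0 : 0 < tau by lra.
have pi0 := @pi_gt0 R.
have gtau : g t * tau = N%:R * pi by rewrite gt -mulrA mulVf ?mulr1 ?gt_eqF// mulrC.
(* The lower bound on [N] says that $W<\pi N/(N+1)$, and [tau < N + 1] makes [g t] larger than
   that. *)
have Wg : W < g t.
  rewrite gt ltr_pdivlMr//.
  move: WN; rewrite ltr_pdivrMr; last by lra.
  have : W * tau < W * (N%:R + 1) by rewrite ltr_pM2l//; lra.
  lra.
have gpi : g t <= pi.
  by rewrite gt -mulrA ler_piMr ?(ltW pi0)// ler_pdivrMr// mul1r; lra.
have sN : sin (g t * tau) = 0 by rewrite gtau; have := @sin_intpi R N.
have cN : cos (g t * tau) = 1.
  rewrite gtau -(odd_double_half N) (negbTE Nodd) add0n -muln2.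
  elim: N./2 => [|n IH]; first by rewrite mul0r cos0.
  rewrite mulSn natrD mulrDl addrC cosD IH mul1r.
  by rewrite (mulr_natl pi) cos2pi sin2pi mulr0 subr0.
(* The shift of the index by [m] is absorbed into the phase. *)
have tw : t * w + p = tau * w + (m%:~R * w + p) by rewrite /tau; ring.
rewrite tw; apply: (@trunc_coef_series _ tau (g t) (m%:~R * w + p) w L) => //.
- by rewrite gpi andbT ltr_norml; lra.
- by rewrite gt_eqF.
(* An integer in [[N, N + 1[] is [N], and [tau = N] gives [g t = pi]. *)
- move=> k ktau; move: tauN; rewrite -ktau => /andP[h1 h2].
  have : k = N.
    apply/eqP; rewrite eq_le; apply/andP; split.
      by rewrite -ltzD1 -(@ltr_int R) intrD.
    by rewrite -(@ler_int R).
  by move=> kN; rewrite gt -ktau kN -pmulrn mulfK// gt_eqF.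
have := cvg_partial_sum_reindex (h := fun k => k + m) (h' := fun k => k - m)
  (addrK m) (subrK m) aL.
apply: cvg_trans; rewrite (_ : _ \o _ =
  fun k => trunc_coef tau (g t) k * cos (k%:~R * w + (m%:~R * w + p))) //.
apply/funext => k /=; rewrite coefE -/m -/tau addrK intrD.
by congr (_ * cos _); ring.
Qed.

End Coefficients.

(** * The sampling formula for real functions orthogonal to the test functions *)

Section RealSampling.
Context {R : realType}.
Local Notation mu := (@lebesgue_measure R).

Lemma average_cvg (f : R -> R) (r : R) : continuous f ->
  j.+1%:R * \int[mu]_(s in `[r, r + j.+1%:R^-1]) f s @[j --> \oo] --> f r.
Proof.
move=> cf; apply/cvgrPdist_le => eta eta0.
have /cvgrPdist_le/(_ _ eta0) := cf r.
rewrite /= => /nbhs_ballP[d /= d0 hd].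
have jd : \forall j \near \oo, j.+1%:R^-1 < d.
  have := @cvg_harmonic R; move/cvgrPdist_lt => /(_ _ d0); apply: filterS => j.
  by rewrite sub0r normrN ger0_norm// invr_ge0.
apply: filterS jd => j jd.
set e : R := j.+1%:R^-1 in jd *; have e0 : 0 < e by rewrite invr_gt0.
have fI := @continuous_integrable _ f r (r + e) cf.
have cI (c : R) : mu.-integrable `[r, r + e] (EFin \o (fun=> c)).
  by apply: continuous_integrable => s; exact: cvg_cst.
have Ic c : \int[mu]_(s in `[r, r + e]) c = c * e.
  rewrite Rintegral_cst//= lebesgue_measure_itv/= lte_fin ltrDl e0.
  by rewrite -EFinD/= addrC addKr.
have -> : j.+1%:R = e^-1 by rewrite invrK.
have fs s : `[r, r + e]%classic s -> f r - eta <= f s <= f r + eta.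
  rewrite /= in_itv/= => /andP[rs sr].
  have := hd s; rewrite /ball/= ler_norml.
  have -> : `|r - s| < d by rewrite ltr_norml; lra.
  by move=> /(_ isT); lra.
have h1 := le_Rintegral _ (cI (f r - eta)) fI (fun s hs => proj1 (andP (fs s hs))).
have h2 := le_Rintegral _ fI (cI (f r + eta)) (fun s hs => proj2 (andP (fs s hs))).
rewrite !Ic in h1 h2.
have {}h1 := h1 (measurable_itv _); have {}h2 := h2 (measurable_itv _).
move: h1 h2; set J := Rintegral _ _ _ => h1 h2.
rewrite mulrC ler_norml; apply/andP; split.
  by have : J / e <= f r + eta; [rewrite ler_pdivrMr|lra].
by have : f r - eta <= J / e; [rewrite ler_pdivlMr|lra].
Qed.

Lemma real_sampling (f : R -> R) (a : int -> R) (t C M : R) : continuous f ->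
  (forall s, `|f s| <= C * Num.sqrt (1 + `|s|)) -> 0 <= C ->
  (forall A, partial_sum (fun k => `|a k| * Num.sqrt (1 + `|k%:~R|)) A <= M) ->
  (forall e, 0 < e <= 1 -> \int[mu]_s (f s * test_fun t a e s) = 0) ->
  partial_sum (fun k : int => a k * f k%:~R) @ totally --> f t.
Proof.
move=> cf fC C0 aM ortho.
pose J (r e : R) := \int[mu]_(s in `[r, r + e]) f s.
pose u_ (j : nat) (k : int) := a k * (j.+1%:R * J k%:~R j.+1%:R^-1).
(* The majorant must not depend on [j]: on an interval of length at most 1 starting at [k], the root
   grows at most by the factor 2. *)
pose v (k : int) := 2 * C * (`|a k| * Num.sqrt (1 + `|k%:~R|)).
have vM A : partial_sum v A <= 2 * C * M.
  have := ler_wpM2l (_ : 0 <= 2 * C) (aM A).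
  rewrite !partial_sumE mulr_sumr; apply.
  by rewrite mulr_ge0.
have v0 k : 0 <= v k by rewrite !mulr_ge0// sqrtr_ge0.
have e01 (j : nat) : 0 < (j.+1%:R^-1 : R) <= 1.
  by rewrite invr_gt0 ltr0n/= invf_le1// ler1n.
have uv j k : `|u_ j k| <= v k.
  have [e0 e1] := andP (e01 j).
  have e01' : 0 <= (j.+1%:R^-1 : R) <= 1 by rewrite e1 ltW.
  rewrite /u_ /v normrM mulrCA ler_wpM2l// normrM ger0_norm//.
  have := Rintegral_growth k%:~R cf fC C0 e01'.
  have : `|J k%:~R j.+1%:R^-1| <=
      \int[mu]_(s in `[k%:~R, k%:~R + j.+1%:R^-1]) `|f s|.
    by apply: le_normr_Rintegral => //; exact: continuous_integrable.
  move=> /le_trans/[apply] h.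
  by move: h; rewrite ler_pdivlMr// mulrC.
have sv (w : int -> R) : (forall k, `|w k| <= v k) -> cvg (partial_sum w @ totally).
  move=> wv; apply: (@cvg_partial_sum _ _ _ (2 * C * M)) => A.
  by apply: le_trans (vM A); exact: ler_partial_sum.
have afv k : `|a k * f k%:~R| <= v k.
  rewrite normrM /v mulrCA ler_wpM2l//; apply: (le_trans (fC _)).
  by rewrite ler_wpM2r ?sqrtr_ge0//; lra.
(* Absolute summability gives a limit along [totally]; its value is read off along the sets
   [zball n]. *)
have uJ j : partial_sum (u_ j) @ totally --> j.+1%:R * J t j.+1%:R^-1.
  have [e0 e1] := andP (e01 j).
  have e01' : 0 <= (j.+1%:R^-1 : R) <= 1 by rewrite e1 ltW.
  have [_] := Rintegral_mul_test_fun t cf fC C0 e01' aM.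
  rewrite (ortho _ (e01 j)) subr0 => h.
  have ul := sv _ (uv j).
  have := cvg_totally_comp ul near_zball => ul'.
  have h' : partial_sum (u_ j) (zball n) @[n --> \oo] --> j.+1%:R * J t j.+1%:R^-1.
    have : j.+1%:R * partial_sum (fun k => a k * J k%:~R j.+1%:R^-1) (zball n)
        @[n --> \oo] --> j.+1%:R * J t j.+1%:R^-1.
      by apply: cvgM; [exact: cvg_cst|exact: h].
    apply: cvg_trans.
    apply: near_eq_cvg; apply: nearW => n; rewrite /= !partial_sumE mulr_sumr.
    by apply: eq_bigr => k _; rewrite /u_ mulrCA.
  suff <- : lim (partial_sum (u_ j) @ totally) = j.+1%:R * J t j.+1%:R^-1 by [].
  exact: (cvg_unique (@Rhausdorff R) ul' h').
have := sv _ afv => afl.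
have := tannery vM uv _ uJ afl => H.
have {}H : j.+1%:R * J t j.+1%:R^-1 @[j --> \oo] -->
    lim (partial_sum (fun k : int => a k * f k%:~R) @ totally).
  by apply: H => k; apply: cvgM; [exact: cvg_cst|exact: average_cvg].
suff <- : lim (partial_sum (fun k : int => a k * f k%:~R) @ totally) = f t by [].
have E : j.+1%:R * J t j.+1%:R^-1 @[j --> \oo] --> f t by exact: average_cvg.
exact: (cvg_unique (@Rhausdorff R) H E).
Qed.

(** The series of integrals over the teeth has two expressions for its limit: the integral over
    [[t, t + e]] minus the one in question, and, by [aL] at suitable phases, the integral over
    [[t, t + e]] alone. *)
Lemma Rintegral_cos_test_fun (a : int -> R) (t M w p e : R) :
  (forall A, partial_sum (fun k => `|a k| * Num.sqrt (1 + `|k%:~R|)) A <= M) ->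
  (forall q L, partial_sum (fun k => a k * cos (k%:~R * w + q)) @ totally --> L ->
     L = cos (t * w + q)) ->
  0 < e <= 1 ->
  \int[mu]_s (cos (w * s + p) * test_fun t a e s) = 0.
Proof.
move=> aM aL /andP[e0 e1].
have e01 : 0 <= e <= 1 by rewrite e1 ltW.
have sq (s : R) : 1 <= Num.sqrt (1 + `|s|).
  by rewrite -{1}[1]sqrtr1 ler_wsqrtr// lerDl.
have aq q : partial_sum (fun k => a k * cos (k%:~R * w + q)) (zball n) @[n --> \oo]
     --> cos (t * w + q).
  have := @cvg_partial_sum _ _ (fun k => a k * cos (k%:~R * w + q)) M.
  move=> H; have {}H : cvg (partial_sum (fun k => a k * cos (k%:~R * w + q)) @ totally).
    apply: H => A; apply: le_trans (aM A); apply: ler_partial_sum => k _.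
    rewrite normrM ler_wpM2l//; apply: le_trans (sq _); exact: cos_max.
  rewrite -(aL q _ H); exact: (cvg_totally_comp H near_zball).
have c1 s : `|cos (w * s + p)| <= 1 * Num.sqrt (1 + `|s|).
  by rewrite mul1r (le_trans (cos_max _)).
have [_ h] := Rintegral_mul_test_fun t (@continuous_cos_affine _ w p) c1 ler01 e01 aM.
pose J (r : R) := \int[mu]_(s in `[r, r + e]) cos (w * s + p).
(* The primitive, a sine, is written as a cosine moved by a quarter turn, so that [J r] combines
   terms [cos (r * w + q)] with [q] independent of [r]. *)
have JE (r : R) : J r = if w == 0 then e * cos (r * w + p)
    else (cos (r * w + (w * e + p - pi / 2)) - cos (r * w + (p - pi / 2))) / w.
  rewrite /J Rintegral_cos_affine; last by rewrite lerDl ltW.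
  case: eqVneq => [->|w0]; first by rewrite mulr0 add0r addrC addKr.
  by rewrite !addrA !cosBpihalf mulrDr [w * r]mulrC.
have h' : partial_sum (fun k => a k * J k%:~R) (zball n) @[n --> \oo] --> J t.
  rewrite JE; case: ifPn => [w0|w0].
    have : e * partial_sum (fun k => a k * cos (k%:~R * w + p)) (zball n)
        @[n --> \oo] --> e * cos (t * w + p).
      by apply: cvgM; [exact: cvg_cst|exact: aq].
    apply: cvg_trans.
    apply: near_eq_cvg; apply: nearW => n; rewrite /= !partial_sumE mulr_sumr.
    by apply: eq_bigr => k _; rewrite JE w0 mulrCA.
  have : (partial_sum (fun k => a k * cos (k%:~R * w + (w * e + p - pi / 2))) (zball n)
      - partial_sum (fun k => a k * cos (k%:~R * w + (p - pi / 2))) (zball n)) / w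
      @[n --> \oo] -->
      (cos (t * w + (w * e + p - pi / 2)) - cos (t * w + (p - pi / 2))) / w.
    by apply: cvgM; [apply: cvgB; exact: aq|exact: cvg_cst].
  apply: cvg_trans; apply: near_eq_cvg; apply: nearW => n.
  rewrite /= !partial_sumE -sumrB mulr_suml.
  by apply: eq_bigr => k _; rewrite JE (negbTE w0) -mulrBr mulrA.
have hJ : J t - \int[mu]_s (cos (w * s + p) * test_fun t a e s) = J t.
  exact: (cvg_unique (@Rhausdorff R) h h').
by apply/eqP; rewrite -oppr_eq0; apply/eqP; apply: (addrI (J t)); rewrite addr0.
Qed.

End RealSampling.

(** * Complex limits through real and imaginary parts *)

Section ComplexLimits.
Context {R : realType}.

Lemma normr_complexE (z : R[i]) : `|z| = (Normc.normc z)%:C.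
Proof. by rewrite normc_def; case: z. Qed.

Lemma normc_ge0 (z : R[i]) : 0 <= Normc.normc z.
Proof. by case: z => a b; exact: sqrtr_ge0. Qed.

Lemma normc_realM (c : R) (z : R[i]) : Normc.normc (c%:C * z) = `|c| * Normc.normc z.
Proof. by rewrite Normc.normcM /= expr0n/= addr0 sqrtr_sqr. Qed.

Lemma Re_realM (c : R) (z : R[i]) : complex.Re (c%:C * z) = c * complex.Re z.
Proof. by case: z => a b /=; rewrite mul0r subr0. Qed.

Lemma Im_realM (c : R) (z : R[i]) : complex.Im (c%:C * z) = c * complex.Im z.
Proof. by case: z => a b /=; rewrite mul0r addr0. Qed.

Lemma norm_Re_le (z : R[i]) : `|complex.Re z| <= Normc.normc z.
Proof.
case: z => a b /=; rewrite -sqrtr_sqr ler_wsqrtr// lerDl; exact: sqr_ge0.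
Qed.

Lemma norm_Im_le (z : R[i]) : `|complex.Im z| <= Normc.normc z.
Proof.
case: z => a b /=; rewrite -sqrtr_sqr ler_wsqrtr// lerDr; exact: sqr_ge0.
Qed.

Lemma normc_le (z : R[i]) : Normc.normc z <= `|complex.Re z| + `|complex.Im z|.
Proof.
case: z => a b /=; rewrite -[leRHS]ger0_norm ?addr_ge0// -sqrtr_sqr ler_wsqrtr//.
rewrite sqrrD !real_normK ?num_real// -addrA [_ *+ 2 + _]addrC addrA lerDl.
by rewrite mulrn_wge0// mulr_ge0.
Qed.

Lemma ReB (z w : R[i]) : complex.Re (z - w) = complex.Re z - complex.Re w.
Proof. by case: z; case: w. Qed.

Lemma ImB (z w : R[i]) : complex.Im (z - w) = complex.Im z - complex.Im w.
Proof. by case: z; case: w. Qed.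

(** The norm of [R[i]^o] takes values in [R[i]], so its radii are complex; positivity forces their
    imaginary part to be 0. *)
Lemma cvg_normcP {T : Type} (F : set_system T) (FF : Filter F) (f : T -> R[i]) (l : R[i]) :
  (f @ F --> (l : R[i]^o)) <->
  (forall e, 0 < e -> \forall x \near F, Normc.normc (l - f x) < e).
Proof.
split.
- move=> fl e e0.
  have := @cvgr_dist_lt R[i] R[i]^o T F FF f l fl e%:C.
  rewrite ltcR => /(_ e0); apply: filterS => x.
  by rewrite normr_complexE ltcR.
- move=> h; apply/(@cvgrPdist_lt R[i] R[i]^o T F FF f l) => e.
  rewrite ltcE/= => /andP[/eqP e1 e0].
  apply: filterS (h _ e0) => x hx.
  by rewrite normr_complexE ltcE/= e1 eqxx.
Qed.

Lemma cvg_Re {T : Type} (F : set_system T) (FF : Filter F) (f : T -> R[i]) (l : R[i]) :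
  f @ F --> (l : R[i]^o) -> complex.Re (f x) @[x --> F] --> complex.Re l.
Proof.
move=> /(cvg_normcP FF) h; apply/cvgrPdist_lt => e e0.
apply: filterS (h _ e0) => x; apply: le_lt_trans.
by rewrite -ReB norm_Re_le.
Qed.

Lemma cvg_Im {T : Type} (F : set_system T) (FF : Filter F) (f : T -> R[i]) (l : R[i]) :
  f @ F --> (l : R[i]^o) -> complex.Im (f x) @[x --> F] --> complex.Im l.
Proof.
move=> /(cvg_normcP FF) h; apply/cvgrPdist_lt => e e0.
apply: filterS (h _ e0) => x; apply: le_lt_trans.
by rewrite -ImB norm_Im_le.
Qed.

Lemma cvg_complex {T : Type} (F : set_system T) (FF : Filter F) (f : T -> R[i]) (l : R[i]) :
  complex.Re (f x) @[x --> F] --> complex.Re l ->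
  complex.Im (f x) @[x --> F] --> complex.Im l ->
  f @ F --> (l : R[i]^o).
Proof.
move=> /cvgrPdist_lt hRe /cvgrPdist_lt hIm; apply/(cvg_normcP FF) => e e0.
have e20 : 0 < e / 2 by rewrite divr_gt0.
have h1 := hRe _ e20; have h2 := hIm _ e20.
apply: filterS2 h1 h2 => x h1 h2; apply: (le_lt_trans (normc_le _)).
by rewrite ReB ImB [ltRHS]splitr ltrD.
Qed.

Lemma Re_partial_sum {I : choiceType} (u : I -> R[i]) (A : {fset I}) :
  complex.Re (partial_sum u A) = partial_sum (fun k => complex.Re (u k)) A.
Proof.
rewrite !partial_sumE; elim: (enum_fset A) => [|k s IH]; first by rewrite !big_nil.
by rewrite !big_cons -IH; case: (u k) => ? ?; case: (\sum_(_ <- _) _).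
Qed.

Lemma Im_partial_sum {I : choiceType} (u : I -> R[i]) (A : {fset I}) :
  complex.Im (partial_sum u A) = partial_sum (fun k => complex.Im (u k)) A.
Proof.
rewrite !partial_sumE; elim: (enum_fset A) => [|k s IH]; first by rewrite !big_nil.
by rewrite !big_cons -IH; case: (u k) => ? ?; case: (\sum_(_ <- _) _).
Qed.

End ComplexLimits.

(** * Growth of the signal and admissibility of the test functions *)

Section BandLimitedSignals.
Context {R : realType}.
Local Notation mu := (@lebesgue_measure R).

(** A positive value would persist on an interval of positive length inside a null set. *)
Lemma ae_le_continuous (f : R -> R) : continuous f ->
  (\forall s \ae mu, f s <= 0) -> forall s, f s <= 0.
Proof.
move=> cf [N [mN N0 fN]] s; rewrite leNgt; apply/negP => fs0.
have /cvgrPdist_lt/(_ _ fs0) /nbhs_ballP[d /= d0 hd] := cf s.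
have sub : (`]s, s + d[%classic `<=` N).
  move=> r /=; rewrite in_itv/= => /andP[sr rd]; apply: fN => /= fr.
  have := hd r; rewrite /ball/= => /(_ _).
  have -> : `|s - r| < d by rewrite ltr_norml; lra.
  by move=> /(_ isT); rewrite ltr_norml; lra.
have : mu `]s, s + d[%classic = 0.
  apply/eqP; rewrite eq_le measure_ge0 andbT -N0.
  apply: le_measure; last exact: sub.
  - by apply: mem_set; exact: measurable_itv.
  - exact: mem_set.
rewrite lebesgue_measure_itv/= lte_fin ltrDl d0 -EFinD => -[]; lra.
Qed.

Lemma continuous_sqrt1 : continuous (fun s : R => Num.sqrt (1 + `|s|)).
Proof.
move=> s; apply: continuous_comp; last exact: sqrt_continuous.
by apply: cvgD; [exact: cvg_cst|apply: cvg_norm; exact: cvg_id].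
Qed.

Lemma rho_inv (alpha s : R) : (rho alpha s)^-1 = (1 + `|s|) `^ alpha.
Proof. by rewrite /rho powRN invrK. Qed.

Lemma rho_inv_le (alpha s : R) : alpha < 1 / 2 ->
  (rho alpha s)^-1 <= Num.sqrt (1 + `|s|).
Proof.
move=> a12; rewrite rho_inv -powR12_sqrt ?addr_ge0// ler_powR ?lerDl//; lra.
Qed.

Lemma rho_gt0 (alpha s : R) : 0 < rho alpha s.
Proof. by rewrite powR_gt0// ltr_wpDr. Qed.

(** Continuity makes the essential bound pointwise. It is applied to the absolute values of the real
    and imaginary parts, hence the factor 2 in the witness. *)
Lemma Linfty_weighted_growth (alpha : R) (x : R -> R[i]) : alpha < 1 / 2 ->
  Linfty_weighted (rho alpha) x -> continuous (x : R -> R[i]^o) ->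
  exists2 M, 0 <= M & forall s, Normc.normc (x s) <= M * Num.sqrt (1 + `|s|).
Proof.
move=> a12 [_ xoo] cx.
(* The norm of exponent [+oo] is defined by cases on whether the total measure is positive. *)
have mu0 : (0 < mu [set: R])%E.
  have : (mu `[0%R, 1%R]%classic <= mu [set: R])%E.
    apply: le_measure => //; apply: mem_set; first exact: measurable_itv.
    exact: measurableT.
  apply: lt_le_trans; rewrite lebesgue_measure_itv/= lte_fin ltr01.
  by rewrite oppr0 adde0 lte_fin ltr01.
move: xoo; rewrite unlock mu0.
rewrite (_ : abse \o _ = EFin \o (fun s => rho alpha s * Normc.normc (x s))); last first.
  apply/funext => s /=; rewrite ger0_norm// mulr_ge0 ?normc_ge0// ltW//.
  exact: rho_gt0.
move=> /ess_supr_bounded[M hM].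
pose M1 := Num.max M 0.
have growth (f : R -> R) : continuous f -> (forall s, f s <= Normc.normc (x s)) ->
    forall s, f s <= M1 * Num.sqrt (1 + `|s|).
  move=> cf fx s; rewrite -subr_le0; move: s.
  apply: ae_le_continuous.
    move=> s; apply: cvgB; first exact: cf.
    by apply: cvgM; [exact: cvg_cst|exact: continuous_sqrt1].
  apply: filterS hM => s hs; rewrite subr_le0.
  apply: (le_trans (fx s)).
  have r0 := rho_gt0 alpha s.
  apply: (@le_trans _ _ (M1 / rho alpha s)).
    by rewrite ler_pdivlMr// mulrC (le_trans hs)// le_max lexx.
  by rewrite ler_wpM2l ?rho_inv_le// le_max lexx orbT.
have M10 : 0 <= M1 by rewrite le_max lexx orbT.
exists (2 * M1); first by rewrite mulr_ge0.
move=> s; apply: (le_trans (normc_le _)); rewrite -mulrA mulr_natl mulr2n.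
apply: lerD.
  apply: (growth (fun s => `|complex.Re (x s)|)) => [r|r]; last exact: norm_Re_le.
  by apply: cvg_norm; apply: cvg_Re; exact: cx.
apply: (growth (fun s => `|complex.Im (x s)|)) => [r|r]; last exact: norm_Im_le.
by apply: cvg_norm; apply: cvg_Im; exact: cx.
Qed.

(** The inverse weight is at most $\sqrt{1+|s|}$, and this root is itself an admissible [f], with
    constant 1, in [Rintegral_mul_test_fun]. *)
Lemma L1_weighted_test_fun (alpha t e M : R) (a : int -> R) : alpha < 1 / 2 ->
  (forall A, partial_sum (fun k => `|a k| * Num.sqrt (1 + `|k%:~R|)) A <= M) ->
  0 <= e <= 1 ->
  L1_weighted (rho alpha) (fun s => (test_fun t a e s)%:C).
Proof.
move=> a12 aM e01; have [e0 e1] := andP e01; split.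
  by split; [exact: measurable_test_fun|exact: measurable_cst].
rewrite Lnorm1.
have fC (s : R) : `|Num.sqrt (1 + `|s|)| <= 1 * Num.sqrt (1 + `|s|).
  by rewrite mul1r ger0_norm// sqrtr_ge0.
have [+ _] := Rintegral_mul_test_fun t continuous_sqrt1 fC ler01 e01 aM.
move=> /integrableP[mf]; apply: le_lt_trans; apply: ge0_le_integral => //.
- apply/measurable_EFinP; apply: measurableT_comp => //; apply: measurable_funM.
    under eq_fun do rewrite rho_inv.
    apply: (@measurableT_comp _ _ _ _ _ _ (@powR R ^~ alpha)) => //.
    by apply: measurable_funD => //; exact: measurableT_comp.
  rewrite (_ : (fun s => _) = (fun s => `|test_fun t a e s|)); last first.
    by apply/funext => s; rewrite /= expr0n/= addr0 sqrtr_sqr.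
  by apply: measurableT_comp => //; exact: measurable_test_fun.
- exact: measurableT_comp.
- move=> s _; rewrite /= lee_fin !normrM (ger0_norm (sqrtr_ge0 _)).
  apply: ler_pM => //.
    rewrite ger0_norm ?invr_ge0 ?(ltW (rho_gt0 _ _))//.
    by rewrite ger0_norm ?sqrtr_ge0// rho_inv_le.
  by rewrite [0 ^+ 2]expr0n/= addr0 sqrtr_sqr.
Qed.

Lemma fourier_test_fun (t M w e : R) (a : int -> R) :
  (forall A, partial_sum (fun k => `|a k| * Num.sqrt (1 + `|k%:~R|)) A <= M) ->
  (forall q L, partial_sum (fun k => a k * cos (k%:~R * w + q)) @ totally --> L ->
     L = cos (t * w + q)) ->
  0 < e <= 1 ->
  fourier (fun s => (test_fun t a e s)%:C) w = 0.
Proof.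
move=> aM aL e01; rewrite /fourier /cintegral.
have -> : (fun s => complex.Re ((cos (w * s) -i* sin (w * s)) * (test_fun t a e s)%:C)) =
    (fun s => cos (w * s + 0) * test_fun t a e s).
  by apply/funext => s /=; rewrite addr0 mulr0 subr0.
(* The phase [pi / 2] produces [- sin], the imaginary part of the Fourier kernel. *)
have -> : (fun s => complex.Im ((cos (w * s) -i* sin (w * s)) * (test_fun t a e s)%:C)) =
    (fun s => cos (w * s + pi / 2) * test_fun t a e s).
  by apply/funext => s /=; rewrite cosDpihalf mulr0 add0r.
by rewrite !(Rintegral_cos_test_fun _ aM aL e01).
Qed.

Lemma band_limited_ortho (alpha W t M e : R) (a : int -> R) (x : R -> R[i]) :
  alpha < 1 / 2 -> band_limited (rho alpha) W x ->
  (forall A, partial_sum (fun k => `|a k| * Num.sqrt (1 + `|k%:~R|)) A <= M) ->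
  (forall w q L, - W < w < W ->
     partial_sum (fun k => a k * cos (k%:~R * w + q)) @ totally --> L ->
     L = cos (t * w + q)) ->
  0 < e <= 1 ->
  \int[mu]_s (complex.Re (x s) * test_fun t a e s) = 0 /\
  \int[mu]_s (complex.Im (x s) * test_fun t a e s) = 0.
Proof.
move=> a12 [_ xV] aM aL e01; have [e0 e1] := andP e01.
have := xV (fun s => (test_fun t a e s)%:C).
move=> /(_ (L1_weighted_test_fun t a12 aM _)).
rewrite (ltW e0) e1 => /(_ isT) H.
have {}H : cintegral (fun s => x s * (test_fun t a e s)%:C) = 0.
  by apply: H => w wW; apply: (fourier_test_fun aM) => // q L; exact: aL.
move: H; rewrite /cintegral => -[].
have -> : (fun s => complex.Re (x s * (test_fun t a e s)%:C)) =
    (fun s => complex.Re (x s) * test_fun t a e s).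
  by apply/funext => s; case: (x s) => p q /=; rewrite mulr0 subr0.
have -> : (fun s => complex.Im (x s * (test_fun t a e s)%:C)) =
    (fun s => complex.Im (x s) * test_fun t a e s).
  by apply/funext => s; case: (x s) => p q /=; rewrite mulr0 add0r.
by [].
Qed.

End BandLimitedSignals.

(** * Absolute and uniform convergence of the sampling series *)

Section SamplingTheorem.
Context {R : realType}.

Lemma sampling_weight_bound (N : nat) (g : R -> R) (t : R) : exists M,
  forall A, partial_sum (fun k => `|coef N g k t| * Num.sqrt (1 + `|k%:~R|)) A <= M.
Proof.
set K := (Num.bound (2 * (`|t| + N%:R + 2))).
have TK : 2 * (`|t| + N%:R + 2) <= K%:R.
  by apply/ltW/archi_boundP; rewrite mulr_ge0// !addr_ge0.
have K0 : (0 < K)%N.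
  rewrite -(@ltr_nat R); apply: lt_le_trans TK.
  by rewrite mulr_gt0// ltr_wpDl// addr_ge0.
have D0 : 0 <= 4 * (N%:R + 1) :> R by rewrite mulr_ge0// addr_ge0.
eexists; apply: (bounded_partial_sum K0 D0) => k.
  by rewrite mulr_ge0// sqrtr_ge0.
exact: coef_bound.
Qed.

Lemma normc_sampling_term_le (N : nat) (g : R -> R) (x : R -> R[i]) (M t : R) (k : int) :
  (forall s, Normc.normc (x s) <= M * Num.sqrt (1 + `|s|)) ->
  Normc.normc (sampling_term N g x t k) <=
  M * (`|coef N g k t| * Num.sqrt (1 + `|k%:~R|)).
Proof. by move=> xM; rewrite /sampling_term normc_realM mulrCA ler_wpM2l. Qed.

Lemma cvg_sampling_normc (N : nat) (g : R -> R) (x : R -> R[i]) (M t : R) :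
  0 <= M -> (forall s, Normc.normc (x s) <= M * Num.sqrt (1 + `|s|)) ->
  cvg (partial_sum (fun k => Normc.normc (sampling_term N g x t k)) @ totally).
Proof.
move=> M0 xM; have [B aB] := sampling_weight_bound N g t.
apply: (@cvg_partial_sum _ _ _ (M * B)) => A.
apply: le_trans (ler_wpM2l M0 (aB A)); rewrite !partial_sumE mulr_sumr.
apply: ler_sum => k _; rewrite ger0_norm ?normc_ge0//.
exact: normc_sampling_term_le.
Qed.

Lemma sampling_uniform (N : nat) (g : R -> R) (x : R -> R[i]) (M : R) (I : set R) :
  0 <= M -> (forall s, Normc.normc (x s) <= M * Num.sqrt (1 + `|s|)) ->
  bounded_set I ->
  {uniform I,
    (fun A t => partial_sum (fun k => Normc.normc (sampling_term N g x t k)) A)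
      @ totally -->
    (fun t => sum (fun k => Normc.normc (sampling_term N g x t k)))}.
Proof.
move=> M0 xM /pinfty_ex_gt0[T /ltW T0 IT] P /uniform_nbhs[E [entE EP]].
move: entE; rewrite -entourage_ballE => -[e /= e0 eE].
pose D := M * (4 * (N%:R + 1)).
have D0 : 0 <= D by rewrite !mulr_ge0// addr_ge0.
(* The first summand makes [coef_bound] available for all [t] in [I], the second brings the tail
   [D * (4 / Num.sqrt K%:R)] down to [e / 2], and the successor keeps [K] positive. *)
pose K := (Num.bound (2 * (T + N%:R + 2)) + Num.bound ((8 * D / e) ^+ 2)).+1.
have K1 : 2 * (T + N%:R + 2) <= K%:R.
  apply: (@le_trans _ _ (Num.bound (2 * (T + N%:R + 2)))%:R).
    by apply/ltW/archi_boundP; rewrite mulr_ge0// !addr_ge0.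
  by rewrite ler_nat leqW// leq_addr.
have K2 : D * (4 / Num.sqrt K%:R) < e.
  have sK : 0 < Num.sqrt K%:R :> R by rewrite sqrtr_gt0.
  rewrite mulrA ltr_pdivrMr// mulrC -ltr_pdivrMl//.
  have : 8 * D / e <= Num.sqrt K%:R.
    rewrite -[leLHS]ger0_norm ?divr_ge0 ?mulr_ge0// ?(ltW e0)// -sqrtr_sqr ler_wsqrtr//.
    apply: (@le_trans _ _ (Num.bound ((8 * D / e) ^+ 2))%:R).
      by apply/ltW/archi_boundP; exact: sqr_ge0.
    by rewrite ler_nat leqW// leq_addl.
  have : 0 <= D / e by rewrite divr_ge0// ltW.
  rewrite -[8 * D / e]mulrA (_ : e^-1 * _ = 4 * (D / e)); last first.
    by ring.
  by move: sK; set q := D / e; lra.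
apply: (@near_totally _ (zball K)) => B KB; apply: EP => t It; apply: eE => /=.
rewrite /ball/=; apply: le_lt_trans K2.
apply: (partial_sum_lim_le (v := fun k => Normc.normc (sampling_term N g x t k))).
- by move=> k; rewrite ger0_norm// normc_ge0.
- move=> B' dB'.
  have dK : [disjoint B' & zball K]%fset.
    by rewrite fdisjoint_sym; exact: fdisjointWl dB'.
  have := ler_wpM2l D0 (partial_sum_zweight (ltn0Sn _) dK).
  apply: le_trans; rewrite !partial_sumE mulr_sumr big_seq [leRHS]big_seq.
  apply: ler_sum => k kB'; apply: (le_trans (normc_sampling_term_le _ _ _ _ xM)).
  rewrite /D -mulrA ler_wpM2l//; apply: (coef_bound _ _ K1).
    exact: IT.
  by move/fdisjointP : dK; apply.
- exact: cvg_sampling_normc xM.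
Qed.

End SamplingTheorem.

Theorem theorem2p3 (R : realType) (alpha Omega : R) (N : nat) (g : R -> R)
    (alpha_range : 0 <= alpha < 1 / 2) (Omega_range : 0 < Omega < pi)
    (N_gt0 : (0 < N)%N) (N_even : ~~ odd N)
    (N_large : Omega / (pi - Omega) < N%:R)
    (g_periodic : periodic g 1)
    (g_def : forall t : R, N%:R <= t < N%:R + 1 -> g t = pi * N%:R / t)
    (x : R -> R[i]) (xV : band_limited (rho alpha) Omega x)
    (x_cont : continuous (x : R -> R[i]^o)) :
  [/\ forall t, partial_sum (sampling_term N g x t : int -> R[i]^o) @ totally --> (x t : R[i]^o),
      forall t, cvg (partial_sum (fun k => Normc.normc (sampling_term N g x t k))
                       @ totally) &
      forall I : set R, is_interval I -> bounded_set I ->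
        {uniform I,
          (fun A t => partial_sum (fun k => Normc.normc (sampling_term N g x t k)) A)
            @ totally -->
          (fun t => sum (fun k => Normc.normc (sampling_term N g x t k)))}].
Proof.
have [_ a12] := andP alpha_range.
have [M M0 xM] := Linfty_weighted_growth a12 (proj1 xV) x_cont.
split=> [t|t|I _]; last 2 first.
- exact: cvg_sampling_normc xM.
- exact: sampling_uniform xM.
have [B aB] := sampling_weight_bound N g t.
have ortho e : 0 < e <= 1 -> _ :=
  band_limited_ortho a12 xV aB (fun w q L wW => coef_series N_gt0 N_even
    g_periodic g_def Omega_range N_large wW).
(* The coefficients are real, so the formula is proved separately for the real and imaginary parts
   of the signal. *)
apply: cvg_complex.
- have := @real_sampling R (fun s => complex.Re (x s)) (coef N g ^~ t) t M B.
  move=> H; have {}H : partial_sum (fun k : int => coef N g k t * complex.Re (x k%:~R)) @ totally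
      --> complex.Re (x t).
    apply: H => //.
    + by move=> s; apply: cvg_Re; exact: x_cont.
    + by move=> s; apply: le_trans (xM s); exact: norm_Re_le.
    + by move=> e /ortho[].
  apply: cvg_trans H; apply: near_eq_cvg; apply: nearW => A.
  rewrite Re_partial_sum; congr (partial_sum _ A); apply/funext => k.
  by rewrite /sampling_term Re_realM.
- have := @real_sampling R (fun s => complex.Im (x s)) (coef N g ^~ t) t M B.
  move=> H; have {}H : partial_sum (fun k : int => coef N g k t * complex.Im (x k%:~R)) @ totally
      --> complex.Im (x t).
    apply: H => //.
    + by move=> s; apply: cvg_Im; exact: x_cont.
    + by move=> s; apply: le_trans (xM s); exact: norm_Im_le.
    + by move=> e /ortho[].
  apply: cvg_trans H; apply: near_eq_cvg; apply: nearW => A.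
  rewrite Im_partial_sum; congr (partial_sum _ A); apply/funext => k.
  by rewrite /sampling_term Im_realM.
Qed.
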